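(* Let $n\ge 3$ and $N>2$ be integers and let $f\colon[0,1)\to\mathbb{R}$ be a potential function. Let $c\in\mathbb{R}$ and, for each integer $k\ge 0$, let $F_k$ be an infinite real symmetric matrix, with rows and columns indexed by the nonnegative integers of the same parity as $k$, having only finitely many nonzero entries. Suppose $$H(u,v,t)=c+\sum_{k\ge 0}\langle F_k,\widehat{T}^n_k(u,v,t)\rangle$$ (the series being assumed to converge on $D$), with $F_k\succeq 0$ for all $k$ and $$H(u,v,t)\le\frac{f(u^2)+f(v^2)+f(t^2)}{3}$$ for all $(u,v,t)\in D$. Then the minimal value of $\widehat{E}_f$ for $N$ points in $\mathbb{R}\mathbb{P}^{n-1}$ is at least $$\frac N2\big((N-1)c-\langle F_0,J\rangle\big),$$ i.e. $\widehat{E}_f(\mathcal{C})\ge\frac N2\big((N-1)c-\langle F_0,J\rangle\big)$ for every set $\mathcal{C}$ of $N$ points in $\mathbb{R}\mathbb{P}^{n-1}$.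
   Context: Points of $\mathbb{R}\mathbb{P}^{n-1}$ are represented by unit vectors in $S^{n-1}\subset\mathbb{R}^n$ determined up to sign; one (arbitrary) representative is chosen for each point. For $f\colon[0,1)\to\mathbb{R}$ and a finite set $\mathcal{C}\subset\mathbb{R}\mathbb{P}^{n-1}$, $\widehat{E}_f(\mathcal{C})=\frac12\sum_{x,y\in\mathcal{C},\,x\ne y}f\big(\langle x,y\rangle^2\big)$. Set $$D=\{(u,v,t)\in\mathbb{R}^3:-1<u,v,t<1\text{ and }1+2uvt-u^2-v^2-t^2\ge 0\}.$$ For $m\ge 2$, $P^m_k$ denotes the degree $k$ Gegenbauer polynomial for $S^{m-1}$: these polynomials are orthogonal with respect to $(1-t^2)^{(m-3)/2}\,dt$ on $[-1,1]$ and normalized by $P^m_k(1)=1$. $S^n_k(u,v,t)$ is the infinite matrix whose $(i,j)$-entry ($i,j=0,1,2,\dots$) is the symmetrization in $u,v,t$ (the average over all $6$ permutations of the variables) of $$u^iv^j\big((1-u^2)(1-v^2)\big)^{k/2}P^{n-1}_k\left(\frac{t-uv}{\sqrt{(1-u^2)(1-v^2)}}\right),$$ which is a polynomial in $u,v,t$ (and is interpreted as such wherever the formula is undefined). $\widehat{S}^n_k$ is the submatrix of $S^n_k$ with rows and columns indexed by the numbers $i,j$ of the same parity as $k$, and $$\widehat{T}^n_k(u,v,t)=(N-2)\widehat{S}^n_k(u,v,t)+\widehat{S}^n_k(u,u,1)+\widehat{S}^n_k(v,v,1)+\widehat{S}^n_k(t,t,1).$$ $J$ is the matrix (with the same index set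 as $F_0$) with all entries $1$. The inner product of symmetric matrices is $\langle A,B\rangle=\mathrm{tr}(AB)=\sum_{i,j}A_{i,j}B_{i,j}$. $A\succeq 0$ means that $A$ is symmetric and positive semidefinite. *)

(* Defs.v *)
(* MathComp-Analysis; the real numbers are an abstract [R : realType]. *)
From HB Require Import structures.
From mathcomp Require Import all_boot all_order all_algebra finmap.
From mathcomp Require Import all_classical all_reals all_analysis.
From mathcomp Require Import ring lra.
Import Order.TTheory GRing.Theory Num.Theory.
Import numFieldNormedType.Exports.

Set Implicit Arguments.
Unset Strict Implicit.
Unset Printing Implicit Defensive.

Local Open Scope classical_set_scope.
Local Open Scope ring_scope.

Section Configurations.
Variables (R : realType) (n : nat).

Definition dot (x y : 'rV[R]_n) : R := \sum_(i < n) x 0 i * y 0 i.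

(* A finite subset of the projective space RP^(n-1), given by one unit vector
   for each of its points: distinct representatives are not antipodal. *)
Definition projective_config (C : {fset 'rV[R]_n}) : Prop :=
  (forall x, x \in C -> dot x x = 1) /\
  (forall x y, x \in C -> y \in C -> x != y -> x != - y).

(* Only the values of f on [0, 1) matter when C is a projective
   configuration. *)
Definition energy (f : R -> R) (C : {fset 'rV[R]_n}) : R :=
  2^-1 * \sum_(x <- C) \sum_(y <- C | x != y) f (dot x y ^+ 2).

End Configurations.

Section Gegenbauer.
Variable R : realType.

(* [P k] is the degree k Gegenbauer polynomial for the sphere S^(m-1) in R^m.
   For m = 2 the weight is unbounded but integrable; the value 0 that [powR]
   gives it at t = 1 and t = -1 is irrelevant. *)
Definition is_gegenbauer (m : nat) (P : nat -> {poly R}) : Prop :=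
  [/\ forall k, size (P k) = k.+1,
      forall k l, k != l ->
        (\int[@lebesgue_measure R]_(t in `[(-1)%R, 1%R])
           ((P k).[t] * (P l).[t] *
            (1 - t ^+ 2) `^ ((m%:R - 3) / 2))%:E = 0)%E
    & forall k, (P k).[1] = 1].

(* The polynomial in u, v, t that equals
     ((1 - u^2) (1 - v^2))^(k/2) p((t - u v) / sqrt ((1 - u^2) (1 - v^2)))
   where the latter makes sense.  A Gegenbauer polynomial p of degree k has the
   parity of k, so it has no coefficients p`_j other than those in the sum. *)
Definition zonal (p : {poly R}) (k : nat) (u v t : R) : R :=
  \sum_(j < k.+1 | odd j == odd k)
     p`_j * (t - u * v) ^+ j * ((1 - u ^+ 2) * (1 - v ^+ 2)) ^+ (k - j)./2.

Lemma zonalE (p : {poly R}) (k : nat) (u v t : R) :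
  size p = k.+1 -> (forall j, odd j != odd k -> p`_j = 0) ->
  -1 < u < 1 -> -1 < v < 1 ->
  zonal p k u v t =
  ((1 - u ^+ 2) * (1 - v ^+ 2)) `^ (k%:R / 2) *
  p.[(t - u * v) / Num.sqrt ((1 - u ^+ 2) * (1 - v ^+ 2))].
Proof.
move=> szp parp /andP[u1 u2] /andP[v1 v2].
set w := (1 - u ^+ 2) * (1 - v ^+ 2).
have w0 : 0 < w by rewrite mulr_gt0//; nra.
have s0 : Num.sqrt w != 0 by rewrite gt_eqF// sqrtr_gt0.
have sw : Num.sqrt w ^+ 2 = w by rewrite sqr_sqrtr// ltW.
have -> : w `^ (k%:R / 2) = Num.sqrt w ^+ k.
  by rewrite mulrC powRrM powR12_sqrt ?(ltW w0)// powR_mulrn// sqrtr_ge0.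
rewrite horner_coef szp mulr_sumr /zonal big_mkcond; apply: eq_bigr => j _.
case: ifPn => [/eqP jk|jk]; last by rewrite parp// mul0r mulr0.
have lejk : (j <= k)%N by rewrite -ltnS.
have -> : w ^+ (k - j)./2 = Num.sqrt w ^+ (k - j).
  rewrite -{1}sw -exprM mul2n halfK oddB// jk addbb subn0.
  by [].
have -> : Num.sqrt w ^+ k = Num.sqrt w ^+ (k - j) * Num.sqrt w ^+ j.
  by rewrite -exprD subnK.
rewrite expr_div_n.
have sj : Num.sqrt w ^+ j != 0 by rewrite expf_neq0.
by field.
Qed.

End Gegenbauer.

Section InfiniteMatrices.
Variable R : realType.

Definition finitely_supported (I : choiceType) (A : I -> I -> R) : Prop :=
  finite_set [set p : I * I | A p.1 p.2 != 0].

Definition psd (I : choiceType) (A : I -> I -> R) : Prop :=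
  (forall i j, A i j = A j i) /\
  (forall (s : {fset I}) (x : I -> R),
     0 <= \sum_(i <- s) \sum_(j <- s) x i * A i j * x j).

(* tr (A B); the sum is the finite one over the nonzero terms, which is
   meaningful as soon as A or B is finitely supported. *)
Definition mxinner (I : choiceType) (A B : I -> I -> R) : R :=
  \sum_(p \in [set: I * I]) A p.1 p.2 * B p.1 p.2.

Definition allones (I : choiceType) : I -> I -> R := fun _ _ => 1.

End InfiniteMatrices.
Arguments allones {R I}.

Definition parity_index (k : nat) : Type := {i : nat | odd i == odd k}.

Section ThreePointMatrices.
Variable R : realType.

Definition Dset (u v t : R) : Prop :=
  [/\ -1 < u < 1, -1 < v < 1, -1 < t < 1 &
      0 <= 1 + 2 * u * v * t - u ^+ 2 - v ^+ 2 - t ^+ 2].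

Definition symmetrize (g : R -> R -> R -> R) (u v t : R) : R :=
  (g u v t + g u t v + g v u t + g v t u + g t u v + g t v u) / 6.

(* In the following, [P] is the family of Gegenbauer polynomials for the sphere
   S^(n-2). *)
Definition Smx (P : nat -> {poly R}) (k : nat) (u v t : R) (i j : nat) : R :=
  symmetrize (fun a b c => a ^+ i * b ^+ j * zonal (P k) k a b c) u v t.

Definition Shat (P : nat -> {poly R}) (k : nat) (u v t : R)
    (i j : parity_index k) : R :=
  Smx P k u v t (val i) (val j).

Definition That (P : nat -> {poly R}) (N k : nat) (u v t : R)
    (i j : parity_index k) : R :=
  (N%:R - 2) * Shat P u v t i j
  + Shat P u u 1 i j + Shat P v v 1 i j + Shat P t t 1 i j.

End ThreePointMatrices.

(* Main.v *)
(* The Gegenbauer kernel is positive definite: for vectors in R^m the polynomial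
   Z_k(y, z) = |y|^k |z|^k P_k(<y, z> / (|y| |z|)) is a sum of products
   h(y) h(z).  This is shown by induction on k: with c = 1 / (m + 2k - 2), the
   operators L_e h = <e, y> h - c |y|^2 d_e h map harmonic functions of degree k
   to harmonic functions of degree k + 1, and summing L_e (in y) L_e (in z) Z_k
   over an orthonormal basis gives a positive multiple of Z_{k+1}.  The
   polynomials produced by this recursion satisfy the Gegenbauer differential
   equation, hence are orthogonal for the weight, hence are the given P_k.

   Applied in the orthogonal complement of each x in C, positivity makes the sum
   of <F_k, S_k> over all triples of C nonnegative (Schur product).  The sum of
   <F_k, T_k> over triples of distinct points is N - 2 times the difference of
   that sum and N <F_k, S_k(1,1,1)>, and the last pairing is <F_0, J> for k = 0
   and vanishes otherwise.  Summing the bound on H over the triples of distinct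
   points then gives the theorem. *)
Require Import Defs.
From HB Require Import structures.
From mathcomp Require Import all_boot all_order all_algebra finmap.
From mathcomp Require Import all_classical all_reals all_analysis.
From mathcomp Require Import measurable_realfun ring lra zify.
Import Order.TTheory GRing.Theory Num.Theory.
Import numFieldNormedType.Exports.

Set Implicit Arguments.
Unset Strict Implicit.
Unset Printing Implicit Defensive.

Local Open Scope classical_set_scope.
Local Open Scope ring_scope.

(** * Integration against the Gegenbauer weight *)

Section Exhaustion.
Variable R : realType.
Implicit Types f F : R -> R.
Notation mu := (@lebesgue_measure R).
Notation openI := (`](-1)%R, 1%R[%classic : set R).

(** Integrands may blow up at -1 and 1, hence an exhaustion by compact intervals; the shift by 2
    keeps [radius 0] positive. *)
Definition radius (k : nat) : R := 1 - k.+2%:R^-1.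

Lemma radius_gt0 k : 0 < radius k.
Proof. by rewrite subr_gt0 invf_lt1 ?ltr0n// ltr1n. Qed.

Lemma radius_lt1 k : radius k < 1.
Proof. by rewrite gtrBl invr_gt0 ltr0n. Qed.

Lemma radius_cvg1 : radius k @[k --> \oo] --> (1 : R).
Proof.
rewrite -[X in _ --> X]subr0; apply: cvgB; first exact: cvg_cst.
have := @cvg_harmonic R; rewrite -cvg_shiftS /harmonic; exact.
Qed.

Lemma radius_near (t : R) : `]-1, 1[%classic t ->
  \forall k \near \oo, `[- radius k, radius k]%classic t.
Proof.
rewrite /= in_itv/= => /andP[t1 t2].
have /cvgr_gt h := radius_cvg1.
have t1' : - t < 1 by lra.
near=> k; rewrite /= in_itv/=.
have : t < radius k by near: k; exact: h.
have : - t < radius k by near: k; exact: h.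
lra.
Unshelve. all: by end_near. Qed.

Lemma radius_sub k : `[- radius k, radius k] `<=` (`]-1, 1[ : set R).
Proof.
move=> t; rewrite /= !in_itv/=.
have := radius_lt1 k; lra.
Qed.

Lemma radius_nd k l : (k <= l)%N ->
  `[- radius k, radius k] `<=` (`[- radius l, radius l] : set R).
Proof.
move=> kl t; rewrite /= !in_itv/=.
have : radius k <= radius l.
  by rewrite lerD2l lerN2 lef_pV2 ?posrE ?ltr0n// ler_nat.
lra.
Qed.

Definition cutoff f k : R -> \bar R := (EFin \o f) \_ `[- radius k, radius k].

Lemma integral_cutoff f F k :
  (forall t : R, -1 < t < 1 -> is_derive t 1 F (f t)) ->
  (forall t : R, -1 < t < 1 -> {for t, continuous f}) ->
  (\int[mu]_(t in openI) cutoff f k t =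
   (F (radius k) - F (- radius k))%:E)%E.
Proof.
move=> dF cf.
rewrite -integral_mkcondr setIidr; last exact: radius_sub.
have r0 := radius_gt0 k.
have inD (t : R) : t \in `[- radius k, radius k] -> -1 < t < 1.
  by move=> tk; have := @radius_sub k t tk; rewrite /= in_itv.
have dF' (t : R) : t \in `[- radius k, radius k] -> derivable F t 1.
  by move=> /inD /dF [].
rewrite EFinB; apply: continuous_FTC2; first lra.
- by apply: continuous_in_subspaceT => t; rewrite inE/= => /inD; exact: cf.
- have : {within `[- radius k, radius k], continuous F}.
    by apply: derivable_within_continuous.
  move/continuous_within_itvP => /(_ ltac:(lra))[_ c1 c2]; split => //.
  by move=> t /subset_itv_oo_cc; exact: dF'.
- move=> t /subset_itv_oo_cc/inD/dF[_ <-]; exact: derive1E.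
Qed.

Lemma cutoff_cvg f t : `]-1, 1[%classic t ->
  cutoff f k t @[k --> \oo] --> (f t)%:E.
Proof.
move=> /radius_near Dt.
apply: cvg_near_cst; apply: filterS Dt => k tk.
by rewrite /cutoff patchE mem_set.
Qed.

Lemma measurable_cutoff f k : measurable_fun openI f ->
  measurable_fun openI (cutoff f k).
Proof.
move=> mf; apply/measurable_restrict => //.
rewrite setIidr; last exact: radius_sub.
apply/measurable_EFinP; apply: measurable_funS mf => //; exact: radius_sub.
Qed.

Lemma continuous_measurable_itv f :
  (forall t : R, -1 < t < 1 -> {for t, continuous f}) -> measurable_fun openI f.
Proof.
move=> cf; apply: open_continuous_measurable_fun => // t.
by rewrite inE/= in_itv/=; exact: cf.
Qed.

(** The fundamental theorem of calculus applies on each [[- radius k, radius k]]; dominated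
    convergence with bound [|f|] and continuity of [F] at the endpoints give the limit. *)
Lemma integral_itv_antiderivative f F :
  (forall t : R, -1 < t < 1 -> is_derive t 1 F (f t)) ->
  (forall t : R, -1 < t < 1 -> {for t, continuous f}) ->
  continuous F ->
  mu.-integrable openI (EFin \o f) ->
  (\int[mu]_(t in openI) (f t)%:E = (F 1 - F (-1))%:E)%E.
Proof.
move=> dF cf cF intf.
have mf := continuous_measurable_itv cf.
have h : ((F (radius k) - F (- radius k))%:E @[k --> \oo] -->
    \int[mu]_(t in openI) (f t)%:E)%E.
  have -> : (fun k => (F (radius k) - F (- radius k))%:E) =
    (fun k => \int[mu]_(t in openI) cutoff f k t)%E.
    by apply/funext => k; rewrite (integral_cutoff k dF cf).
  apply: (@dominated_cvg _ _ _ mu openI _ (cutoff f) _ (fun t => `|f t|%:E)) => //.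
  - by move=> k; exact: measurable_cutoff.
  - by move=> t Dt; exact: cutoff_cvg.
  - exact: (integrable_abse intf).
  - by move=> k t _; rewrite /cutoff patchE; case: ifPn => //= _; rewrite normr0 lee_fin.
apply: (cvg_unique _ h) => //.
apply: cvg_EFin; first by exact: nearW.
apply: cvgB; apply: cvg_comp; [exact: radius_cvg1| exact: cF| |exact: cF].
by apply: cvgN; exact: radius_cvg1.
Qed.

(** By monotone convergence the integral of [f] is the limit of the increments of [F] over the
    compact intervals, which stay below [2 * c]. *)
Lemma integrable_itv_antiderivative f F :
  (forall t : R, -1 < t < 1 -> is_derive t 1 F (f t)) ->
  (forall t : R, -1 < t < 1 -> {for t, continuous f}) ->
  (forall t : R, -1 < t < 1 -> 0 <= f t) ->
  (exists c : R, forall t : R, -1 < t < 1 -> `|F t| <= c) ->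
  mu.-integrable openI (EFin \o f).
Proof.
move=> dF cf f0 [c Fc].
have mf := continuous_measurable_itv cf.
apply/integrableP; split; first exact/measurable_EFinP.
have f0' t : `]-1, 1[%classic t -> 0 <= f t by rewrite /= in_itv/=; exact: f0.
have -> : (\int[mu]_(t in openI) `|(EFin \o f) t| =
           \int[mu]_(t in openI) (f t)%:E)%E.
  by apply: eq_integral => t; rewrite inE => Dt; rewrite /= ger0_norm// f0'.
apply: (@le_lt_trans _ _ (2 * c)%:E); last exact: ltry.
have h : ((F (radius k) - F (- radius k))%:E @[k --> \oo] -->
    \int[mu]_(t in openI) (f t)%:E)%E.
  have -> : (fun k => (F (radius k) - F (- radius k))%:E) =
    (fun k => \int[mu]_(t in openI) cutoff f k t)%E.
    by apply/funext => k; rewrite (integral_cutoff k dF cf).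
  have -> : (\int[mu]_(t in openI) (f t)%:E = \int[mu]_(t in openI)
     limn (fun k => cutoff f k t))%E.
    apply: eq_integral => t; rewrite inE => Dt.
    by apply/esym/cvg_lim => //; exact: cutoff_cvg.
  apply: cvg_monotone_convergence => //.
  - by move=> k; exact: measurable_cutoff.
  - by move=> k t Dt; rewrite /cutoff patchE; case: ifPn => //= _; rewrite lee_fin f0'.
  - move=> t Dt k l kl; rewrite /cutoff !patchE.
    case: ifPn => [kt|_].
      by rewrite ifT//; move: kt; rewrite !inE; exact: radius_nd.
    by case: ifPn => //= _; rewrite lee_fin f0'.
have <- := cvg_lim (@ereal_hausdorff R) h.
apply: lime_le; first by apply/cvg_ex; eexists; exact: h.
apply: nearW => k; rewrite lee_fin.
have r1 := radius_gt0 k; have r2 := radius_lt1 k.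
have := Fc (radius k) ltac:(lra); have := Fc (- radius k) ltac:(lra).
rewrite !ler_norml; lra.
Qed.

End Exhaustion.

(** * The weighted integral as a linear form on polynomials *)

Section Weight.
Variables (R : realType) (d : nat).
Notation mu := (@lebesgue_measure R).
Notation openI := (`](-1)%R, 1%R[%classic : set R).
Implicit Types p q : {poly R}.

Let mD : measurable (openI : set (g_sigma_algebraType (R.-ocitv.-measurable))).
Proof. exact: measurable_itv. Qed.

Let semicircle (t : R) : R := Num.sqrt (1 - t ^+ 2).

(* The Gegenbauer weight (1 - t^2)^((m-3)/2) for m = d + 2, see [weightE]; for
   d = 0 it is unbounded near 1 and -1. *)
Definition weight (t : R) : R := Num.sqrt (1 - t ^+ 2) ^+ d / Num.sqrt (1 - t ^+ 2).

Let semicircle_gt0 (t : R) : -1 < t < 1 -> 0 < semicircle t.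
Proof. by move=> ht; rewrite sqrtr_gt0; nra. Qed.

Let semicircle_sqr (t : R) : -1 < t < 1 -> semicircle t ^+ 2 = 1 - t ^+ 2.
Proof. by move=> ht; rewrite sqr_sqrtr//; nra. Qed.

Let semicircle_continuous : continuous semicircle.
Proof.
move=> t; apply: (@continuous_comp _ _ _ (fun t : R => 1 - t ^+ 2) Num.sqrt).
  by apply: cvgB; [exact: cvg_cst | apply: exprn_continuous].
exact: sqrt_continuous.
Qed.

Let is_derive_semicircle (t : R) : -1 < t < 1 -> is_derive t 1 semicircle (- t / semicircle t).
Proof.
move=> ht.
have h0 : 0 < 1 - t ^+ 2 by nra.
have := @is_derive1_comp R Num.sqrt (fun t : R => 1 - t ^+ 2) t _ _
  (is_derive1_sqrt h0) _.
have -> : semicircle = Num.sqrt \o (fun t : R => 1 - t ^+ 2) by [].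
move=> h; apply: is_derive_eq.
have := semicircle_gt0 ht; rewrite /semicircle /GRing.scale/=.
set c := Num.sqrt _ => c0.
have c0' : c != 0 by rewrite gt_eqF.
by field.
Qed.

(** Primitive for integration by parts: its factor (1 - t^2)^((d+1)/2) vanishes at both endpoints
    for every [d]. *)
Definition sphere_primitive p (t : R) : R := semicircle t ^+ d.+1 * p.[t].

Lemma is_derive_sphere_primitive p (t : R) : -1 < t < 1 ->
  is_derive t 1 (sphere_primitive p)
    (((1 - 'X^2) * p^`() - d.+1%:R *: ('X * p)).[t] * weight t).
Proof.
move=> ht; have hc := is_derive_semicircle ht.
have h := is_deriveM (is_deriveX d.+1 hc) (is_derive_poly p t).
have -> : sphere_primitive p = semicircle ^+ d.+1 * horner p.
  by apply/funext => x; rewrite /sphere_primitive fctE exprfctE.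
apply: (is_derive_eq h).
have c0 := semicircle_gt0 ht; have c2 := semicircle_sqr ht.
rewrite /weight -/(semicircle t) !hornerE /GRing.scale/= exprfctE -c2 exprS.
have : semicircle t != 0 by rewrite gt_eqF.
by move=> ?; field.
Qed.

Let weight_ge0 (t : R) : 0 <= weight t.
Proof. by rewrite mulr_ge0 ?invr_ge0 ?exprn_ge0// sqrtr_ge0. Qed.

Let semicircleV_continuous (t : R) : -1 < t < 1 -> {for t, continuous (fun t => (semicircle t)^-1)}.
Proof.
move=> ht; apply: continuousV; first by rewrite gt_eqF// semicircle_gt0.
exact: semicircle_continuous.
Qed.

Let density_continuous p (t : R) : -1 < t < 1 ->
  {for t, continuous (fun t => p.[t] * weight t)}.
Proof.
move=> ht; apply: continuousM; first exact: continuous_horner.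
apply: continuousM; last exact: semicircleV_continuous.
apply: (@continuous_comp _ _ _ semicircle (fun x => x ^+ d)).
  exact: semicircle_continuous.
exact: exprn_continuous.
Qed.

Lemma integrable_semicircleV : mu.-integrable openI (EFin \o (fun t => (semicircle t)^-1)).
Proof.
(* [asin] is a bounded antiderivative of 1 / sqrt (1 - t^2). *)
apply: (@integrable_itv_antiderivative _ _ (@asin R)).
- exact: semicircleV_continuous.
- by move=> t _; rewrite invr_ge0 sqrtr_ge0.
- exists (pi / 2) => t /andP[t1 t2]; rewrite ler_norml.
  by rewrite asin_geNpi2 ?asin_lepi2// ltW//= ltW.
Qed.

Lemma horner_bounded p : exists c : R, forall t : R, -1 < t < 1 -> `|p.[t]| <= c.
Proof.
exists (\sum_(i < size p) `|p`_i|) => t ht.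
rewrite horner_coef; apply: (le_trans (ler_norm_sum _ _ _)).
apply: ler_sum => i _; rewrite normrM ler_piMr// normrX exprn_ile1//.
by rewrite ler_norml; lra.
Qed.

(** On the open interval [p] is bounded and the [d]-th power in [weight] is at most 1, so a multiple
    of the weight for [d = 0] dominates. *)
Lemma integrable_density p :
  mu.-integrable openI (EFin \o (fun t => p.[t] * weight t)).
Proof.
have [c pc] := horner_bounded p.
have h := integrableZl mD c integrable_semicircleV.
apply: (le_integrable mD _ _ h).
  apply/measurable_EFinP; apply: continuous_measurable_itv.
  exact: density_continuous.
move=> t; rewrite /= in_itv/= => ht.
have c0 := semicircle_gt0 ht; have hc := pc _ ht; have a0 := normr_ge0 p.[t].
rewrite lee_fin [leLHS]normrM [leRHS]normrM (ger0_norm (weight_ge0 t)).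
rewrite (ger0_norm (le_trans a0 hc)) normfV (gtr0_norm c0).
apply: ler_pM => //; rewrite /weight -/(semicircle t) ler_piMl ?invr_ge0 ?(ltW c0)//.
apply: exprn_ile1; first exact: ltW.
have := semicircle_sqr ht; nra.
Qed.

Definition sphint p : R := (\int[mu]_(t in openI) (p.[t] * weight t))%R.

Lemma sphintD p q : sphint (p + q) = sphint p + sphint q.
Proof.
rewrite /sphint -RintegralD//; try exact: integrable_density.
by apply: eq_Rintegral => t _; rewrite hornerD mulrDl.
Qed.

Lemma sphintZ a p : sphint (a *: p) = a * sphint p.
Proof.
rewrite /sphint -RintegralZl//; last exact: integrable_density.
by apply: eq_Rintegral => t _; rewrite hornerZ -mulrA.
Qed.

Lemma sphint_parts p :
  sphint ((1 - 'X^2) * p^`() - d.+1%:R *: ('X * p)) = 0.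
Proof.
rewrite /sphint /Rintegral.
rewrite (integral_itv_antiderivative (@is_derive_sphere_primitive p)).
- by rewrite /sphere_primitive /semicircle sqrrN !expr1n subrr sqrtr0 !exprS !mul0r subrr.
- exact: density_continuous.
- move=> t; apply: (@continuousM _ _ (fun t => semicircle t ^+ d.+1) (horner p)).
    apply: (@continuous_comp _ _ _ semicircle (fun x => x ^+ d.+1)).
      exact: semicircle_continuous.
    exact: exprn_continuous.
  exact: continuous_horner.
- exact: integrable_density.
Qed.

Lemma finite_set_root p : p != 0 -> finite_set [set t | root p t].
Proof.
move=> p0; apply: contrapT => /(infinite_set_fset (size p))[B Bp].
apply/negP; rewrite -ltnNge; apply: max_poly_roots (fset_uniq B) => //.
by apply/allP => t /Bp.
Qed.

(** If [p] were nonzero, the integrand would vanish almost everywhere yet be positive off finitely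
    many roots, making an interval of length 2 a null set. *)
Lemma sphint_sqr_eq0 p : sphint (p ^+ 2) = 0 -> p = 0.
Proof.
rewrite /sphint => I0; apply/eqP/negPn/negP => p0.
have mp := measurable_int mu (integrable_density (p ^+ 2)).
have {}I0 : (\int[mu]_(t in openI) `|(EFin \o (fun t => ((p ^+ 2).[t] * weight t)%R)) t| = 0)%E.
  have := integrable_fin_num mD (integrable_density (p ^+ 2)).
  move=> /fineK; rewrite -/(Rintegral _ _ _) I0 => h; rewrite [RHS]h.
  apply: eq_integral => t _ /=.
  by rewrite ger0_norm// mulr_ge0// hornerE sqr_ge0.
have [N [mN N0 sN]] := (ae_eq_integral_abs _ mD mp).1 I0.
have cZ := finite_set_countable (finite_set_root p0).
have Z0 := countable_lebesgue_measure0 cZ.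
have mZ := countable_measurable (fun x => measurable_set1 x) cZ.
have : (mu openI <= mu (N `|` [set t | root p t]))%E.
  apply: le_measure; rewrite ?inE//; first exact: measurableU.
  move=> t Dt; have [tp|tp] := boolP (root p t); [by right|left].
  apply: sN => /(_ Dt) [] /eqP; rewrite horner_exp mulf_eq0 expf_eq0/=.
  rewrite -rootE (negPf tp)/=; apply/negP.
  move: Dt; rewrite /= in_itv/= => /semicircle_gt0 c0.
  by rewrite gt_eqF// divr_gt0// exprn_gt0.
rewrite null_set_setU// lebesgue_measure_itv/= ifT; last by rewrite lte_fin; lra.
by rewrite -EFinB lee_fin; lra.
Qed.

Lemma weightE (t : R) : -1 < t < 1 ->
  weight t = (1 - t ^+ 2) `^ ((d.+2%:R - 3) / 2).
Proof.
move=> ht; have c0 : 0 < 1 - t ^+ 2 by nra.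
have -> : (d.+2%:R - 3 : R) = d%:R - 1 by rewrite -!natr1; ring.
rewrite mulrC powRrM powR12_sqrt ?ltW// powRB ?powRr1 ?sqrtr_ge0//; last first.
  by rewrite (gt_eqF (semicircle_gt0 ht)) implybT.
by rewrite powR_mulrn ?sqrtr_ge0.
Qed.

Lemma sphint_gegenbauer (P : nat -> {poly R}) k l :
  is_gegenbauer d.+2 P -> k != l -> sphint (P k * P l) = 0.
Proof.
move=> [_ h _] /h {}h.
have E t : t \in openI -> (((P k * P l).[t] * weight t)%:E =
    ((P k).[t] * (P l).[t] * (1 - t ^+ 2) `^ ((d.+2%:R - 3) / 2))%:E)%E.
  by rewrite inE/= in_itv/= hornerM => /weightE ->.
rewrite /sphint /Rintegral.
under eq_integral => t Dt do rewrite E//.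
rewrite -(integral_itv_bndoo true false) ?h//.
apply: eq_measurable_fun E _.
exact: (measurable_int mu (integrable_density (P k * P l))).
Qed.

End Weight.

(** * Gegenbauer polynomials by a ladder recursion *)

Section ZonalPoly.
Variables (R : realFieldType) (d : nat).
Implicit Types p q : {poly R}.

(* Classically (1 - t^2) P_k' = (k + m - 2) (t P_k - P_{k+1}), with m = d + 2.
   For k = d = 0 the inverse is 0, which is harmless as P_0' = 0. *)
Fixpoint zonal_poly (k : nat) : {poly R} :=
  if k is k'.+1 then
    'X * zonal_poly k'
    - ((k' + d)%:R^-1)%:P * ((1 - 'X^2) * (zonal_poly k')^`())
  else 1.

(** The equation for [k] is used twice: it turns the derivative of the next polynomial into the form
    [r1], free of second derivatives, and it closes the computation after [r1] is differentiated. *)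
Lemma zonal_poly_ode k :
  (1 - 'X^2) * (zonal_poly k)^`()^`() - d.+1%:R * ('X * (zonal_poly k)^`())
  + (k * (k + d))%:R * zonal_poly k = 0.
Proof.
elim: k => [|k IH] /=; first by rewrite -polyC1 !derivC !mulr0 subrr mul0r addr0.
(* For [k = d = 0] the inverse in the recursion is 0 and the next polynomial is ['X]. *)
have [kd|kd] := eqVneq (k + d)%N 0.
  have [-> ->] : k = 0%N /\ d = 0%N by move/eqP: kd; rewrite addn_eq0 => /andP[/eqP + /eqP].
  rewrite /= -polyC1 !derivC !mulr0 subr0 mulr1 derivX derivC /=.
  by rewrite polyC1; ring.
move: IH; rewrite natrM natrD => ode.
set p := zonal_poly k in ode *; set c := (_^-1)%:P.
have ca : c * (k%:R + d%:R) = 1.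
  rewrite -natrD -polyC_natr -polyCM mulVf//.
  by rewrite pnatr_eq0.
have r1 : ('X * p - c * ((1 - 'X^2) * p^`()))^`() = k.+1%:R * (p + c * ('X * p^`())).
  rewrite !poly.derivE/= -/c expr1.
  apply/eqP; rewrite -subr_eq0; apply/eqP.
  transitivity (k%:R * p * (c * (k%:R + d%:R) - 1)
    + 'X * p^`() * (1 - c * (k%:R + d%:R))
    - c * ((1 - 'X^2) * p^`()^`() - d.+1%:R * ('X * p^`()) +
       k%:R * (k%:R + d%:R) * p)).
    rewrite -!natr1; ring.
  by rewrite ode ca !subrr !mulr0 subr0 addr0.
rewrite r1.
have -> : (k.+1%:R * (p + c * ('X * p^`())))^`()
   = k.+1%:R * (p^`() + c * (p^`() + 'X * p^`()^`())).
  rewrite -polyC_natr !poly.derivE/=; ring.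
transitivity (k.+1%:R * ('X * c * ((1 - 'X^2) * p^`()^`() - d.+1%:R * ('X * p^`()) +
       k%:R * (k%:R + d%:R) * p)
   + (k%:R * 'X * p + p^`() * (1 - 'X^2)) * (1 - c * (k%:R + d%:R)))).
  rewrite -addn1 !natrM !natrD -!natr1; ring.
by rewrite ode ca subrr !mulr0 addr0 mulr0.
Qed.

Lemma horner1_zonal_poly k : (zonal_poly k).[1] = 1.
Proof.
elim: k => [|k IH] /=; first by rewrite hornerC.
rewrite hornerD hornerN !hornerM hornerX hornerC hornerD hornerN hornerXn IH.
by rewrite -polyC1 hornerC expr1n subrr mul0r mulr0 subr0 mulr1.
Qed.

Lemma coef_zonal_polyS k j : (k + d != 0)%N ->
  (k + d)%:R * (zonal_poly k.+1)`_j =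
  (if j is j'.+1 then (k + d + j')%:R * (zonal_poly k)`_j' else 0)
  - j.+1%:R * (zonal_poly k)`_j.+1.
Proof.
move=> kd /=; set p := zonal_poly k.
have a0 : (k + d)%:R != 0 :> R by rewrite pnatr_eq0.
rewrite coefB coefXM coefCM mulrBl mul1r coefB coefXnM !coef_deriv.
rewrite mulrBr mulVKf//.
case: j => [|[|j]] /=.
- by ring.
- by ring.
rewrite subn2/= -[_ *+ j.+3]mulr_natl -[_ *+ j.+1]mulr_natl [(k + d + _)%:R]natrD.
ring.
Qed.

Lemma coef_zonal_poly_ode k j :
  (j.+1 * j.+2)%:R * (zonal_poly k)`_j.+2 =
  ((j * (j + d))%:R - (k * (k + d))%:R) * (zonal_poly k)`_j.
Proof.
have cd q i : q^`()`_i = i.+1%:R * q`_i.+1 by rewrite coef_deriv mulr_natl.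
have /(congr1 (fun q : {poly R} => q`_j)) := zonal_poly_ode k.
set p := zonal_poly k.
rewrite -!polyC_natr coefD coefB coef0 !coefCM coefXM mulrBl mul1r coefB coefXnM.
rewrite !cd.
case: j => [|[|j]] /=; rewrite ?subn2/= => h; apply/eqP;
  rewrite -subr_eq0; apply/eqP; rewrite -[RHS]h !natrM ?(natrD _ k d) -?natr1 ?natrD.
- ring.
- ring.
ring.
Qed.

Lemma size_zonal_poly_le k : (size (zonal_poly k) <= k.+1)%N.
Proof.
elim: k => [|k IH]; first by rewrite size_poly1.
apply/leq_sizeP => j kj; apply/eqP.
have [kd|kd] := eqVneq (k + d)%N 0.
  have k0 : k = 0%N by move/eqP: kd; rewrite addn_eq0 => /andP[/eqP].
  by rewrite k0 in kj *; rewrite /= -polyC1 derivC !mulr0 subr0 mulr1 coefX gtn_eqF.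
have /mulfI inj : (k + d)%:R != 0 :> R by rewrite pnatr_eq0.
apply/eqP/inj; rewrite coef_zonal_polyS// mulr0.
case: j kj => // j kj; have z i : (k < i)%N -> (zonal_poly k)`_i = 0.
  by move: IH => /leq_sizeP; exact.
by rewrite (z j)// (z j.+2) ?mulr0 ?subr0//; lia.
Qed.

(** Apart from k = d = 0, each step multiplies the leading coefficient by (2k + d) / (k + d). *)
Lemma lead_zonal_poly_gt0 k : 0 < (zonal_poly k)`_k.
Proof.
elim: k => [|k IH]; first by rewrite coefC.
have [kd|kd] := eqVneq (k + d)%N 0.
  have k0 : k = 0%N by move/eqP: kd; rewrite addn_eq0 => /andP[/eqP].
  by rewrite k0/= -polyC1 derivC !mulr0 subr0 mulr1 coefX.
have a0 : 0 < (k + d)%:R :> R by rewrite ltr0n lt0n.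
rewrite -(pmulr_rgt0 _ a0) coef_zonal_polyS//.
have -> : (zonal_poly k)`_k.+2 = 0.
  by move: (size_zonal_poly_le k) => /leq_sizeP; apply; exact: ltnW.
rewrite mulr0 subr0 mulr_gt0// ltr0n.
by rewrite (leq_trans _ (leq_addr _ _))// lt0n.
Qed.

Lemma size_zonal_poly k : size (zonal_poly k) = k.+1.
Proof.
apply/eqP; rewrite eqn_leq size_zonal_poly_le ltnNge.
apply/negP => /leq_sizeP /(_ k (leqnn k)) h.
by have := lead_zonal_poly_gt0 k; rewrite h ltxx.
Qed.

Lemma coef_zonal_poly_parity k j : odd j != odd k -> (zonal_poly k)`_j = 0.
Proof.
elim: k j => [|k IH] j; first by rewrite coefC; case: j.
move=> jk; have [kd|kd] := eqVneq (k + d)%N 0.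
  have k0 : k = 0%N by move/eqP: kd; rewrite addn_eq0 => /andP[/eqP].
  move: jk; rewrite k0/= -polyC1 derivC !mulr0 subr0 mulr1 coefX.
  by case: j => [|[|j]].
have /mulfI inj : (k + d)%:R != 0 :> R by rewrite pnatr_eq0.
apply/inj; rewrite coef_zonal_polyS// mulr0.
rewrite (IH j.+1); last by move: jk => /=; case: (odd j); case: (odd k).
case: j jk => [|j] jk; rewrite ?mulr0 ?subr0//.
by rewrite IH ?mulr0//; move: jk => /=; case: (odd j); case: (odd k).
Qed.

End ZonalPoly.

(** Polynomials [Q l] of exact degree l < k span everything of degree below [k]: a multiple of the
    top one removes the leading coefficient. *)
Lemma linear_form_eq0 (R : realType) (Q : nat -> {poly R}) (L : {poly R} -> R) k :
  (forall l, size (Q l) = l.+1) ->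
  (forall p q, L (p + q) = L p + L q) -> (forall a p, L (a *: p) = a * L p) ->
  (forall l, (l < k)%N -> L (Q l) = 0) ->
  forall q : {poly R}, (size q <= k)%N -> L q = 0.
Proof.
move=> sQ LD LZ; have L0 : L 0 = 0 by rewrite -(scale0r 0) LZ mul0r.
elim: k => [|k IH] LQ q.
  by rewrite leqn0 size_poly_eq0 => /eqP ->.
move=> sq; have lQ : (Q k)`_k != 0.
  by rewrite -[k in _`_k]/(k.+1.-1) -(sQ k) lead_coef_eq0 -size_poly_eq0 sQ.
pose a := q`_k / (Q k)`_k.
rewrite -(subrK (a *: Q k) q) LD LZ LQ// mulr0 addr0; apply: IH.
  by move=> l lk; apply: LQ; exact: ltnW.
apply/leq_sizeP => j; rewrite leq_eqVlt => /predU1P[<-|kj].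
  by rewrite coefB coefZ divfK// subrr.
rewrite coefB coefZ (leq_sizeP _ _ sq j kj).
by rewrite (leq_sizeP (Q k) k.+1 _ j kj) ?sQ// mulr0 subr0.
Qed.

(** * Identification with the given Gegenbauer polynomials *)

Section Identification.
Variables (R : realType) (d : nat).
Notation Z := (@zonal_poly R d).
Notation I := (@sphint R d).

(** Green's formula for the Gegenbauer operator: integration by parts by [sphint_parts], followed by
    the differential equation. *)
Lemma sphint_zonal_poly_deriv k q :
  I ((1 - 'X^2) * (Z k)^`() * q^`()) = (k * (k + d))%:R * I (Z k * q).
Proof.
rewrite -[RHS]addr0 -(sphint_parts d ((Z k)^`() * q)) -sphintZ -sphintD.
congr I; rewrite poly.derivM -!mul_polyC !polyC_natr.
apply/eqP; rewrite -subr_eq0; apply/eqP.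
transitivity (- q * ((1 - 'X^2) * (Z k)^`()^`() - d.+1%:R * ('X * (Z k)^`())
  + (k * (k + d))%:R * Z k)); first by ring.
by rewrite zonal_poly_ode mulr0.
Qed.

(** The left side of [sphint_zonal_poly_deriv] at [q = Z l] is symmetric in k and l, while the
    eigenvalues k (k + d) are distinct. *)
Lemma sphint_zonal_poly k l : k != l -> I (Z k * Z l) = 0.
Proof.
move=> kl; have := sphint_zonal_poly_deriv l (Z k).
rewrite mulrAC sphint_zonal_poly_deriv [Z l * _]mulrC => /eqP.
rewrite -subr_eq0 -mulrBl mulf_eq0 subr_eq0 eqr_nat => /orP[|/eqP//].
case: (ltngtP k l) kl => // kl _.
  by rewrite ltn_eqF// -(addn0 (k * _)%N); nia.
by rewrite gtn_eqF//; nia.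
Qed.

(** Both [P k] and [Z k] are orthogonal to all lower degrees. The combination [D] that cancels the
    leading terms has lower degree, so it is orthogonal to itself and vanishes; the value at 1 fixes
    the factor [a]. *)
Lemma gegenbauer_zonal_poly (P : nat -> {poly R}) k :
  is_gegenbauer d.+2 P -> P k = Z k.
Proof.
move=> hP; have [sP _ P1] := hP.
have h (p : {poly R}) : (size p <= k)%N -> I (P k * p) = 0.
  apply: (@linear_form_eq0 _ P (fun q => I (P k * q))) => //.
  - by move=> *; rewrite mulrDr sphintD.
  - by move=> *; rewrite -scalerAr sphintZ.
  - by move=> l lk; apply: sphint_gegenbauer hP _; rewrite gtn_eqF.
have h' (p : {poly R}) : (size p <= k)%N -> I (Z k * p) = 0.
  apply: (@linear_form_eq0 _ Z (fun q => I (Z k * q))).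
  - exact: size_zonal_poly.
  - by move=> *; rewrite mulrDr sphintD.
  - by move=> *; rewrite -scalerAr sphintZ.
  - by move=> l lk; apply: sphint_zonal_poly; rewrite gtn_eqF.
pose a := (P k)`_k / (Z k)`_k; pose D := P k + (- a) *: Z k.
have sD : (size D <= k)%N.
  apply/leq_sizeP => j; rewrite leq_eqVlt => /predU1P[<-|kj].
    by rewrite coefD coefZ mulNr divfK ?subrr// gt_eqF// lead_zonal_poly_gt0.
  rewrite coefD coefZ (leq_sizeP (P k) k.+1 _ j kj) ?sP// add0r.
  by rewrite (leq_sizeP (Z k) k.+1 _ j kj) ?mulr0// size_zonal_poly.
have D0 : D = 0.
  apply: (@sphint_sqr_eq0 _ d).
  by rewrite expr2 {1}/D mulrDl -scalerAl sphintD sphintZ h// h'// mulr0 addr0.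
have PE : P k = a *: Z k.
  by apply/eqP; rewrite -subr_eq0 -scaleNr -/D D0.
have := congr1 (horner^~ 1) PE; rewrite /= hornerZ P1 horner1_zonal_poly mulr1.
by rewrite PE => <-; rewrite scale1r.
Qed.
End Identification.

(** * Positive definiteness of zonal kernels *)

Section Interpolation.
Variable R : realFieldType.
Implicit Types (f g : R -> R).

(* Differentiation at 0 is a finite combination of evaluations, so it can be
   applied to functions only known through a kernel they generate. *)
Lemma coef1_interpolation N : exists lam : seq (R * R), forall q : {poly R},
  (size q <= N)%N -> \sum_(p <- lam) p.1 * q.[p.2] = q`_1.
Proof.
(* The nodes 0, ..., N - 1 are distinct, so the Vandermonde matrix is invertible and weights [lam]
   exist that pick out the coefficient of degree 1. *)
pose a : 'rV[R]_N := \row_j (nat_of_ord j)%:R.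
have Vu : Vandermonde N a \in unitmx.
  rewrite unitmxE det_Vandermonde unitfE; apply/prodf_neq0 => i _.
  apply/prodf_neq0 => j ij; rewrite !mxE -natrB ?pnatr_eq0 ?subn_eq0 -?ltnNge//.
  exact: ltnW.
pose lam := invmx (Vandermonde N a) *m (\col_(i < N) ((i : nat) == 1)%:R).
exists [seq (lam j 0, a 0 j) | j : 'I_N] => q sq.
rewrite big_map big_enum/=.
transitivity (\sum_(i < N) q`_i * (\sum_j Vandermonde N a i j * lam j 0)).
  under eq_bigr do rewrite (horner_coef_wide _ sq) mulr_sumr.
  rewrite exchange_big/=; apply: eq_bigr => i _; rewrite mulr_sumr.
  by apply: eq_bigr => j _; rewrite [Vandermonde _ _ _ _]mxE; ring.
under eq_bigr => i _.
  have := congr1 (fun M : 'cV[R]_N => M i 0) (mulKVmx Vu (\col_(i < N) ((i : nat) == 1)%:R)).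
  rewrite -/lam mxE => ->; rewrite mxE.
  over.
have [N1|N1] := ltnP 1 N.
  rewrite (bigD1 (Ordinal N1))//= mulr1 big1 ?addr0// => i.
  by rewrite -val_eqE/= => /negPf ->; rewrite mulr0.
(* For [N <= 1] both sides are 0. *)
rewrite [RHS](leq_sizeP _ _ sq)// big1// => i _.
by rewrite ltn_eqF ?mulr0// (leq_trans (ltn_ord i)).
Qed.

(** First-order expansion at 0 of a polynomial function; the degree bound [n] makes
    [coef1_interpolation] applicable. *)
Definition jet n f (u v : R) := exists q : {poly R},
  [/\ (size q <= n.+1)%N, forall x, f x = q.[x], q`_0 = u & q`_1 = v].

Lemma jet_cst a : jet 0 (fun=> a) a 0.
Proof.
exists a%:P; split; rewrite ?coefC ?size_polyC//.
- by case: (a != 0).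
- by move=> x; rewrite hornerC.
Qed.

Lemma jet_poly2 a b c : jet 2 (fun x => a + x * b + x ^+ 2 * c) a b.
Proof.
exists (Poly [:: a; b; c]); split; rewrite ?coef_Poly//.
- exact: size_Poly.
- by move=> x; rewrite horner_Poly/=; ring.
Qed.

Lemma jet_poly1 a b : jet 1 (fun x => a + x * b) a b.
Proof.
exists (Poly [:: a; b]); split; rewrite ?coef_Poly//.
- exact: size_Poly.
- by move=> x; rewrite horner_Poly/=; ring.
Qed.

Lemma jetW m n f u v : (m <= n)%N -> jet m f u v -> jet n f u v.
Proof. by move=> mn [q [sq ? ? ?]]; exists q; split => //; exact: leq_trans sq _. Qed.

Lemma jetD n f g u v u' v' : jet n f u v -> jet n g u' v' ->
  jet n (fun x => f x + g x) (u + u') (v + v').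
Proof.
move=> [p [sp fp <- <-]] [q [sq gq <- <-]]; exists (p + q); split; rewrite ?coefD//.
- by rewrite (leq_trans (size_polyD _ _))// geq_max sp.
- by move=> x; rewrite hornerD fp gq.
Qed.

Lemma jetM m n f g u v u' v' : jet m f u v -> jet n g u' v' ->
  jet (m + n) (fun x => f x * g x) (u * u') (u * v' + v * u').
Proof.
move=> [p [sp fp <- <-]] [q [sq gq <- <-]]; exists (p * q); split.
- rewrite (leq_trans (size_polyMleq _ _))//.
  by rewrite -subn1 leq_subLR (leq_trans (leq_add sp sq))// addSn addnS add1n.
- by move=> x; rewrite hornerM fp gq.
- by rewrite coefM big_ord1.
- by rewrite coefM big_ord_recr/= big_ord1.
Qed.

Lemma jetX n f u v j : jet n f u v ->
  jet (n * j) (fun x => f x ^+ j) (u ^+ j) (j%:R * u ^+ j.-1 * v).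
Proof.
move=> h; elim: j => [|j IH]; first by rewrite muln0 !mul0r; exact: jet_cst.
have := jetM h IH; rewrite mulnS -exprS.
have -> : (fun x => f x * f x ^+ j) = (fun x => f x ^+ j.+1).
  by apply/funext => x; rewrite exprS.
congr jet; case: j IH => [|j] _; rewrite ?expr0/= ?exprS -!natr1; ring.
Qed.

End Interpolation.

(** * Raising operators on zonal monomials *)

Section Kernel.
Variables (R : rcfType) (d : nat) (V : lmodType R).
(** In the application [beta] is the inner product of projections orthogonal to a unit vector x, a
    degenerate form on the whole space, and [frame] is the standard basis, whose projections form a
    Parseval frame. *)
Variables (beta : V -> V -> R) (frame : seq V).
Hypothesis betaC : forall y z, beta y z = beta z y.
Hypothesis betaD : forall y e z a, beta (y + a *: e) z = beta y z + a * beta e z.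
Hypothesis frame_dot : forall y z, \sum_(e <- frame) beta e y * beta e z = beta y z.
Hypothesis frame_trace : \sum_(e <- frame) beta e e = d.+2%:R.

Let betaDr y e z a : beta z (y + a *: e) = beta z y + a * beta z e.
Proof. by rewrite betaC betaD [beta y z]betaC [beta e z]betaC. Qed.

(* When [lam] comes from [coef1_interpolation], [line_comb lam e] is the
   derivative in the direction e of functions polynomial along lines. *)
Definition line_comb (lam : seq (R * R)) (e : V) (h : V -> R) (y : V) : R :=
  \sum_(p <- lam) p.1 * h (y + p.2 *: e).

(** The operator L_e, with the directional derivative computed by [line_comb]. *)
Definition raise (lam : seq (R * R)) (c : R) (e : V) (h : V -> R) (y : V) : R :=
  beta e y * h y - c * beta y y * line_comb lam e h y.

Lemma raise_sum lam c e (I : Type) (r : seq I) (a : I -> R) (h : I -> V -> R) y :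
  raise lam c e (fun y => \sum_(i <- r) a i * h i y) y =
  \sum_(i <- r) a i * raise lam c e (h i) y.
Proof.
rewrite /raise /line_comb mulr_sumr.
under [X in _ - _ * X]eq_bigr do rewrite mulr_sumr.
rewrite exchange_big/= mulr_sumr -sumrB; apply: eq_bigr => i _.
rewrite mulrBr; congr (_ - _); first by ring.
rewrite mulr_sumr mulr_sumr mulr_sumr; apply: eq_bigr => p _; ring.
Qed.

(** The form of positive definiteness that raising propagates: the raised features expand the raised
    kernel. *)
Definition features (K : V -> V -> R) := exists hs : seq (V -> R),
  forall y z, K y z = \sum_(h <- hs) h y * h z.

Definition monomial_kernel j i y z := beta y z ^+ j * (beta y y * beta z z) ^+ i.

Section Raise.
Variables (k : nat) (lam : seq (R * R)).
(** Degree k + 2 leaves room for the jets below: at [j = 0] the truncated [j.-1] makes a formal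
    degree exceed j + 2i by one. *)
Hypothesis lamP : forall q : {poly R},
  (size q <= k.+3)%N -> \sum_(p <- lam) p.1 * q.[p.2] = q`_1.

Let line_comb_jet n f e h y u v :
  jet n f u v -> (n <= k.+2)%N -> (forall x, h (y + x *: e) = f x) ->
  line_comb lam e h y = v.
Proof.
move=> [q [sq fq _ <-]] nk hf; rewrite -lamP; last exact: leq_trans sq _.
by apply: eq_bigr => p _; rewrite hf fq.
Qed.

Let jet_norm e y : jet 2 (fun x => beta (y + x *: e) (y + x *: e))
  (beta y y) (2 * beta e y).
Proof.
have := jet_poly2 (beta y y) (2 * beta e y) (beta e e).
congr jet; apply/funext => x; rewrite betaD !betaDr [beta y e]betaC; ring.
Qed.

Let jet_dot e y z : jet 1 (fun x => beta (y + x *: e) z) (beta y z) (beta e z).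
Proof.
have := jet_poly1 (beta y z) (beta e z).
by congr jet; apply/funext => x; rewrite betaD.
Qed.

Lemma raise_monomial c e j i y z : (j + 2 * i <= k)%N ->
  raise lam c e (monomial_kernel j i y) z =
  (1 - 2 * c * i%:R) * beta e z * beta y z ^+ j * (beta y y * beta z z) ^+ i
  - c * j%:R * beta z z * beta e y * beta y z ^+ j.-1 * (beta y y * beta z z) ^+ i.
Proof.
move=> ji; rewrite /raise.
have J1 := jetX j (jet_dot e z y).
have J2 := jetX i (jetM (jet_cst (beta y y)) (jet_norm e z)).
rewrite (line_comb_jet (jetM J1 J2)); first last.
- by move=> x; rewrite /monomial_kernel [beta y (_ + _)]betaC.
- by lia.
rewrite /monomial_kernel [beta z y]betaC.
(* The factor [beta z z] of the operator restores the power lost in differentiation; at [i = 0] both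
   sides vanish. *)
have W : i%:R * (beta y y * beta z z) ^+ i.-1 * (beta y y * beta z z)
    = i%:R * (beta y y * beta z z) ^+ i.
  by case: (i) => [|i']; rewrite ?mul0r// -mulrA exprSr.
rewrite mulrDr.
transitivity (beta e z * (beta y z ^+ j * (beta y y * beta z z) ^+ i) -
  (c * (2 * beta e z * beta y z ^+ j * (i%:R * (beta y y * beta z z) ^+ i.-1 * (beta y y * beta z z))) +
   c * beta z z * (j%:R * beta y z ^+ j.-1 * beta e y * (beta y y * beta z z) ^+ i))).
  ring.
rewrite W; ring.
Qed.

Lemma raise2_monomial c e j i y z : (j + 2 * i <= k)%N ->
  raise lam c e (fun y => raise lam c e (monomial_kernel j i y) z) y =
  let s := beta y z in let W := beta y y * beta z z in
  (1 - 2 * c * i%:R) * s ^+ j * W ^+ i * (1 - 2 * c * i%:R)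
    * (beta e y * beta e z)
  - c * j%:R * (1 - 2 * c * i%:R) * s ^+ j.-1 * W ^+ i * beta z z
    * (beta e y * beta e y)
  - c * j%:R * (1 - 2 * c * i%:R) * s ^+ j.-1 * W ^+ i * beta y y
    * (beta e z * beta e z)
  + c ^+ 2 * j%:R * W ^+ i * W * s ^+ j.-1 * beta e e
  + c ^+ 2 * j%:R * j.-1%:R * s ^+ j.-2 * W ^+ i * W * (beta e y * beta e z).
Proof.
move=> ji; rewrite {1}/raise raise_monomial//=.
have J1 := jetX j (jet_dot e y z).
have J1' := jetX j.-1 (jet_dot e y z).
have J2 := jetX i (jetM (jet_norm e y) (jet_cst (beta z z))).
have J3 := jet_dot e y e.
have Ja := jetM (jetM (jet_cst ((1 - 2 * c * i%:R) * beta e z)) J1) J2.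
have Jb := jetM (jetM (jetM (jet_cst (- c * j%:R * beta z z)) J3) J1') J2.
have leA : (0 + 1 * j + (2 + 0) * i <= k.+2)%N by lia.
have leB : (0 + 1 + 1 * j.-1 + (2 + 0) * i <= k.+2)%N by lia.
have J := jetD (jetW leA Ja) (jetW leB Jb).
rewrite (line_comb_jet J)//; last first.
  by move=> x; rewrite raise_monomial// [beta e (_ + _)]betaC; ring.
have W : i%:R * (beta y y * beta z z) ^+ i.-1 * (beta y y * beta z z)
    = i%:R * (beta y y * beta z z) ^+ i.
  by case: (i) => [|i']; rewrite ?mul0r// -mulrA exprSr.
rewrite [beta y e]betaC; apply/eqP; rewrite -subr_eq0; apply/eqP.
transitivity ((2 * c ^+ 2 * j%:R * beta z z * beta e y ^+ 2 * beta y z ^+ j.-1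
    - 2 * c * (1 - 2 * c * i%:R) * beta e z * beta y z ^+ j * beta e y) *
  (i%:R * (beta y y * beta z z) ^+ i.-1 * (beta y y * beta z z) -
   i%:R * (beta y y * beta z z) ^+ i)); first by ring.
by rewrite W subrr mulr0.
Qed.

(** Summing over the frame turns <e, y><e, z> into <y, z>, <e, y>^2 into |y|^2 and <e, e> into d +
    2, so the result is again zonal, of degree one higher. *)
Lemma sum_raise2_monomial c j i y z : (j + 2 * i <= k)%N ->
  \sum_(e <- frame) raise lam c e (fun y => raise lam c e (monomial_kernel j i y) z) y =
  (1 - 2 * c * i%:R) ^+ 2 * monomial_kernel j.+1 i y z
  + j%:R * (c ^+ 2 * (d%:R + j%:R + 1 + 4 * i%:R) - 2 * c)
    * monomial_kernel j.-1 i.+1 y z.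
Proof.
move=> ji.
under eq_bigr do rewrite raise2_monomial//=.
rewrite !big_split/= !sumrN -!mulr_sumr !frame_dot frame_trace /monomial_kernel.
have S : j%:R * j.-1%:R * beta y z ^+ j.-2 * beta y z =
    j%:R * (j%:R - 1) * beta y z ^+ j.-1.
  case: (j) => [|[|j']]; rewrite ?mul0r ?subrr ?mulr0 ?mul0r//.
  by rewrite /= -mulrA -exprSr -[j'.+2%:R]natr1 addrK.
apply/eqP; rewrite -subr_eq0; apply/eqP.
transitivity (c ^+ 2 * (beta y y * beta z z) ^+ i * (beta y y * beta z z) *
  (j%:R * j.-1%:R * beta y z ^+ j.-2 * beta y z - j%:R * (j%:R - 1) * beta y z ^+ j.-1)).
  rewrite !exprS -[d.+2%:R]natr1 -[d.+1%:R]natr1; ring.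
by rewrite S subrr mulr0.
Qed.

End Raise.
End Kernel.

(** * The zonal kernel under the ladder recursion *)

Section ZonalKernel.
Variables (R : realFieldType) (d : nat).
Implicit Types (p : {poly R}) (s W : R).

(* [zonal] in terms of s = <y, z> and W = |y|^2 |z|^2, where y and z stand for
   the projections on the complement of x. *)
Definition zonal_kernel p k s W : R :=
  \sum_(j < k.+1 | odd j == odd k) p`_j * s ^+ j * W ^+ (k - j)./2.

Lemma sum_ord_shift1 (x : nat -> R) n :
  x 0%N = 0 -> x n.+1 = 0 -> x n.+2 = 0 ->
  \sum_(l < n.+2) x l.+1 = \sum_(j < n.+1) x j.
Proof.
move=> x0 x1 x2; transitivity (\sum_(j < n.+3) x j).
  by rewrite [RHS]big_ord_recl/= x0 add0r.
by rewrite !big_ord_recr/= x1 x2 !addr0.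
Qed.

Lemma sum_ord_shift2 (x : nat -> R) n :
  x 0%N = 0 -> x 1%N = 0 -> x n.+1 = 0 -> x n.+2 = 0 ->
  \sum_(l < n.+1) x l.+2 = \sum_(j < n.+1) x j.
Proof.
move=> x0 x1 x2 x3; transitivity (\sum_(j < n.+3) x j).
  by rewrite [RHS]big_ord_recl/= x0 add0r [RHS]big_ord_recl/= x1 add0r.
by rewrite !big_ord_recr/= x2 x3 !addr0.
Qed.

Let Z := @zonal_poly R d.

Lemma zonal_kernelE k s W :
  zonal_kernel (Z k) k s W = \sum_(j < k.+1) (Z k)`_j * s ^+ j * W ^+ (k - j)./2.
Proof.
rewrite /zonal_kernel big_mkcond; apply: eq_bigr => j _.
by case: ifPn => // /coef_zonal_poly_parity ->; rewrite !mul0r.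
Qed.

(** The left side is the double raising of the kernel of degree k, as given by
    [sum_raise2_monomial]. Two coefficient identities reduce it to the next kernel: the ladder
    recursion and the differential equation. *)
Lemma zonal_kernelS k s W : (0 < k)%N ->
  let c : R := (2 * k + d)%:R^-1 in
  \sum_(j < k.+1 | odd j == odd k) (Z k)`_j *
    ((1 - 2 * c * (k - j)./2%:R) ^+ 2 * (s ^+ j.+1 * W ^+ (k - j)./2)
     + j%:R * (c ^+ 2 * (d%:R + j%:R + 1 + 4 * (k - j)./2%:R) - 2 * c)
       * (s ^+ j.-1 * W ^+ (k - j)./2.+1))
  = c * (k + d)%:R * zonal_kernel (Z k.+1) k.+1 s W.
Proof.
move=> k0 c; have kd : (k + d != 0)%N by lia.
have cE : c * (2 * k%:R + d%:R) = 1.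
  by rewrite -natrM -natrD mulVf// pnatr_eq0; lia.
have Z0 j : (k < j)%N -> (Z k)`_j = 0.
  by move=> kj; apply: (leq_sizeP (Z k) k.+1 _ j kj); rewrite size_zonal_poly.
pose X j := (Z k)`_j * (s ^+ j.+1 * W ^+ (k - j)./2).
pose Y j := j%:R * (Z k)`_j * (s ^+ j.-1 * W ^+ (k.+2 - j)./2).
have Zs : (k + d)%:R * zonal_kernel (Z k.+1) k.+1 s W =
    \sum_(j < k.+1) (k + d + j)%:R * X j - \sum_(j < k.+1) Y j.
  rewrite zonal_kernelE mulr_sumr.
  transitivity (\sum_(l < k.+2) ((if l : nat is l'.+1 then (k + d + l')%:R * X l' else 0)
      - Y l.+1)).
    apply: eq_bigr => l _; rewrite !mulrA coef_zonal_polyS// /X /Y.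
    case: l => [[|l] lk]/=; rewrite ?subSS; ring.
  rewrite sumrB; congr (_ - _).
    by rewrite big_ord_recl/= add0r.
  apply: (sum_ord_shift1 (x := Y)); rewrite /Y; first by rewrite !mul0r.
    by rewrite Z0// mulr0 mul0r.
  by rewrite Z0 ?mulr0 ?mul0r//; exact: ltnW.
(* The differential equation on coefficients, after an index shift by 2. *)
have XY : \sum_(j < k.+1) (j%:R - 1) * Y j =
    \sum_(j < k.+1) ((j * (j + d))%:R - (k * (k + d))%:R) * X j.
  rewrite -(sum_ord_shift2 (x := fun j => (j%:R - 1) * Y j)).
  - apply: eq_bigr => j _; rewrite /X /Y !mulrA -coef_zonal_poly_ode subSS subSS /=.
    rewrite natrM -[j.+2%:R]natr1; ring.
  - by rewrite /Y !mul0r mulr0.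
  - by rewrite subrr mul0r.
  - by rewrite /Y Z0// mulr0 mul0r mulr0.
  - by rewrite /Y Z0 ?mulr0 ?mul0r ?mulr0//; exact: ltnW.
rewrite -mulrA Zs big_mkcond/=.
(* Adding c^2 times the difference of the two sides of [XY], which is 0, makes the sums agree term
   by term. *)
transitivity (\sum_(j < k.+1) (c * ((k + d + j)%:R * X j) - c * Y j
   + c ^+ 2 * (((j * (j + d))%:R - (k * (k + d))%:R) * X j)
   - c ^+ 2 * ((j%:R - 1) * Y j))); last first.
  by rewrite sumrB big_split/= sumrB -!mulr_sumr XY mulrBr addrK.
apply: eq_bigr => j _; case: ifPn => [/eqP jk|/coef_zonal_poly_parity j0]; last first.
  by rewrite /X /Y j0; ring.
have jk' : (j <= k)%N by rewrite -ltnS.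
have i2 : (k.+2 - j)./2 = (k - j)./2.+1 by rewrite -addn2 -addnBAC// addn2.
have iE : (k - j)./2%:R = (k%:R - j%:R) / 2 :> R.
  apply/eqP; rewrite eq_sym -natrB// -{1}[(k - j)%N]odd_double_half.
  by rewrite oddB// jk addbb add0n -mul2n natrM [2 * _]mulrC mulfK ?pnatr_eq0.
rewrite /X /Y i2 iE.
apply/eqP; rewrite -subr_eq0; apply/eqP.
set x := s ^+ j.+1 * _; set y := s ^+ j.-1 * _.
transitivity ((c * (2 * k%:R + d%:R) - 1) * (Z k)`_j *
  (c * j%:R * y + (c * (2 * k%:R + d%:R) - 1 - c * (k%:R + d%:R + j%:R)) * x)).
  by rewrite !natrM !natrD; field.
by rewrite cE subrr !mul0r.
Qed.
End ZonalKernel.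

Section ZonalFeatures.
Variables (R : rcfType) (d : nat) (V : lmodType R).
Variables (beta : V -> V -> R) (frame : seq V).
Hypothesis betaC : forall y z, beta y z = beta z y.
Hypothesis betaD : forall y e z a, beta (y + a *: e) z = beta y z + a * beta e z.
Hypothesis frame_dot : forall y z, \sum_(e <- frame) beta e y * beta e z = beta y z.
Hypothesis frame_trace : \sum_(e <- frame) beta e e = d.+2%:R.

Let K k y z := zonal_kernel (zonal_poly R d k) k (beta y z) (beta y y * beta z z).

Lemma zonal_features k : features (K k).
Proof.
elim: k => [|k [hs hsE]].
  exists [:: fun=> 1] => y z.
  by rewrite big_seq1 /K zonal_kernelE big_ord1 coefC/= !mulr1.
case: k hsE => [_|k hsE].
  (* The step from 0 to 1 is separate, as 2k + d can be 0 there; the kernel of degree 1 is [beta]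
     itself. *)
  exists [seq beta e | e <- frame] => y z.
  have Z1 : zonal_poly R d 1 = 'X.
    by rewrite /= -polyC1 derivC !mulr0 subr0 mulr1.
  by rewrite big_map frame_dot /K zonal_kernelE Z1 !big_ord_recr big_ord0/= !coefX/=; ring.
(* The raising lemmas are used at degree [k.+1], so [lamP] must reach size [k.+4]. *)
have [lam lamP] := @coef1_interpolation R k.+4.
pose c : R := (2 * k.+1 + d)%:R^-1.
have c0 : 0 < c by rewrite invr_gt0 ltr0n.
have a0 : 0 < c * (k.+1 + d)%:R by rewrite mulr_gt0// ltr0n.
(* The new features are the old ones raised in every frame direction; the square root absorbs the
   positive factor of [zonal_kernelS]. *)
exists [seq (fun y => Num.sqrt (c * (k.+1 + d)%:R)^-1 * raise beta lam c e h y)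
  | e <- frame, h <- hs] => y z.
rewrite big_allpairs_dep/=.
transitivity ((c * (k.+1 + d)%:R)^-1 * \sum_(e <- frame) \sum_(h <- hs)
    raise beta lam c e h y * raise beta lam c e h z); last first.
  rewrite mulr_sumr; apply: eq_bigr => e _; rewrite mulr_sumr; apply: eq_bigr => h _.
  rewrite -[in LHS](@sqr_sqrtr _ (c * (k.+1 + d)%:R)^-1); last by rewrite invr_ge0 ltW.
  by ring.
have a1 : c * (k.+1 + d)%:R != 0 by rewrite gt_eqF.
apply: (mulfI a1); rewrite mulVKf// /K.
have /= := zonal_kernelS d (beta y z) (beta y y * beta z z) (ltn0Sn k).
rewrite -/c => <-.
(* By linearity of [raise], the double raising of the kernel is computed both from its features and
   from its monomials. *)
transitivity (\sum_(e <- frame) raise beta lam c e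
   (fun y => raise beta lam c e (fun z => K k.+1 y z) z) y); last first.
  apply: eq_bigr => e _.
  transitivity (raise beta lam c e
      (fun y => \sum_(h <- hs) raise beta lam c e h z * h y) y).
    congr raise; apply/funext => y'.
    transitivity (raise beta lam c e (fun z => \sum_(h <- hs) h y' * h z) z).
      by congr raise; apply/funext => z'; rewrite hsE.
    by rewrite raise_sum; apply: eq_bigr => h _; rewrite mulrC.
  by rewrite raise_sum; apply: eq_bigr => h _; rewrite mulrC.
transitivity (\sum_(e <- frame) \sum_(j < k.+2) (zonal_poly R d k.+1)`_j *
    raise beta lam c e (fun y => raise beta lam c e
      (monomial_kernel beta j (k.+1 - j)./2 y) z) y); last first.
  apply: eq_bigr => e _; rewrite -raise_sum.
  congr raise; apply/funext => y'; rewrite -raise_sum.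
  congr raise; apply/funext => z'; rewrite /K zonal_kernelE.
  by apply: eq_bigr => j _; rewrite mulrA.
rewrite exchange_big big_mkcond/=; apply: eq_bigr => j _.
rewrite -mulr_sumr (sum_raise2_monomial betaC betaD frame_dot frame_trace lamP).
  by case: ifPn => // /(@coef_zonal_poly_parity R d k.+1 j) ->; rewrite mul0r.
by have := ltn_ord j; lia.
Qed.
End ZonalFeatures.

(** * The three-point bound *)

Section Dot.
Variables (R : realType) (n : nat).
Implicit Types x y z : 'rV[R]_n.

Lemma dotC x y : dot x y = dot y x.
Proof. by apply: eq_bigr => i _; rewrite mulrC. Qed.

Lemma dotDl x y z : dot (x + y) z = dot x z + dot y z.
Proof. by rewrite -big_split; apply: eq_bigr => i _; rewrite mxE mulrDl. Qed.

Lemma dotZl a x z : dot (a *: x) z = a * dot x z.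
Proof. by rewrite mulr_sumr; apply: eq_bigr => i _; rewrite mxE mulrA. Qed.

Lemma dotNl x z : dot (- x) z = - dot x z.
Proof. by rewrite -scaleN1r dotZl mulN1r. Qed.

Lemma dotDr x y z : dot z (x + y) = dot z x + dot z y.
Proof. by rewrite !(dotC z) dotDl. Qed.

Lemma dotZr a x z : dot z (a *: x) = a * dot z x.
Proof. by rewrite !(dotC z) dotZl. Qed.

Lemma dotNr x z : dot z (- x) = - dot z x.
Proof. by rewrite !(dotC z) dotNl. Qed.

Lemma dot_ge0 x : 0 <= dot x x.
Proof. by apply: sumr_ge0 => i _; rewrite -expr2 sqr_ge0. Qed.

Lemma dot_gt0 x : x != 0 -> 0 < dot x x.
Proof.
move=> x0; rewrite lt0r dot_ge0 andbT; apply: contra x0.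
rewrite psumr_eq0 => [/allP h|i _]; last by rewrite -expr2 sqr_ge0.
apply/eqP/rowP => i; rewrite mxE.
by have := h i (mem_index_enum i); rewrite /= mulf_eq0 orbb => /eqP.
Qed.

Definition dot_perp x y z : R := dot y z - dot x y * dot x z.

Lemma dot_perpE x y z : dot x x = 1 ->
  dot_perp x y z = dot (y - dot x y *: x) (z - dot x z *: x).
Proof.
move=> x1; rewrite /dot_perp !(dotDl, dotDr, dotNl, dotNr, dotZl, dotZr) x1.
by rewrite (dotC y x); ring.
Qed.

Lemma dot_cauchy_schwarz x y : dot x y ^+ 2 <= dot x x * dot y y.
Proof.
have [->|/dot_gt0 x0] := eqVneq x 0.
  by rewrite -(scale0r 0) !dotZl !mul0r expr0n.
have := dot_ge0 (dot x x *: y - dot x y *: x).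
rewrite !(dotDl, dotDr, dotNl, dotNr, dotZl, dotZr) (dotC y x).
move=> h; rewrite -subr_ge0 -(pmulr_rge0 _ x0); move: h.
by congr (0 <= _); ring.
Qed.

Lemma unit_dot_lt1 x y : dot x x = 1 -> dot y y = 1 -> x != y -> x != - y ->
  -1 < dot x y < 1.
Proof.
move=> x1 y1 xy xNy.
have := @dot_gt0 (x - y); have := @dot_gt0 (x + y).
rewrite subr_eq0 addr_eq0 => /(_ xNy) + /(_ xy).
rewrite !(dotDl, dotDr, dotNl, dotNr) x1 y1 (dotC y x); lra.
Qed.

(** Cauchy-Schwarz for the components of [y] and [z] orthogonal to [x]. *)
Lemma gram3_ge0 x y z : dot x x = 1 -> dot y y = 1 -> dot z z = 1 ->
  0 <= 1 + 2 * dot x y * dot x z * dot y z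
       - dot x y ^+ 2 - dot x z ^+ 2 - dot y z ^+ 2.
Proof.
move=> x1 y1 z1.
have := dot_cauchy_schwarz (y - dot x y *: x) (z - dot x z *: x).
rewrite -!dot_perpE// /dot_perp y1 z1 -subr_ge0.
by congr (0 <= _); ring.
Qed.

End Dot.

Lemma dot_delta (R : realType) n i (w : 'rV[R]_n) : dot (delta_mx 0 i) w = w 0 i.
Proof.
rewrite /dot (bigD1 i)//= big1 ?addr0 ?mxE ?eqxx ?mul1r// => j ji.
by rewrite mxE (negPf ji) andbF mul0r.
Qed.

Lemma zonal_perp_features (R : realType) (d k : nat) (x : 'rV[R]_d.+3) :
  dot x x = 1 ->
  features (fun y z : 'rV[R]_d.+3 => zonal_kernel (zonal_poly R d k) k
    (dot_perp x y z) (dot_perp x y y * dot_perp x z z)).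
Proof.
(* The trace of the projected standard basis is (d + 3) - |x|^2 = d + 2. *)
move=> x1; apply: (@zonal_features _ _ _ _ [seq delta_mx 0 i | i : 'I_d.+3]).
- by move=> y z; rewrite /dot_perp dotC; ring.
- by move=> y e z a; rewrite /dot_perp !dotDl !dotDr !dotZl !dotZr; ring.
- move=> y z; rewrite big_map big_enum/=.
  transitivity (\sum_i (y 0 i * z 0 i - dot x z * (x 0 i * y 0 i)
     - dot x y * (x 0 i * z 0 i) + dot x y * dot x z * (x 0 i * x 0 i))).
    apply: eq_bigr => i _.
    by rewrite /dot_perp (dotC x (delta_mx 0 i)) !dot_delta; ring.
  rewrite big_split/= !sumrB -!mulr_sumr.
  rewrite -/(dot x y) -/(dot x z) -/(dot x x) -/(dot y z) x1 /dot_perp; ring.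
- rewrite big_map big_enum/=.
  transitivity (\sum_i (1 - (x 0 i * x 0 i))).
    apply: eq_bigr => i _.
    by rewrite /dot_perp (dotC x (delta_mx 0 i)) !dot_delta mxE !eqxx.
  by rewrite sumrB -/(dot x x) x1 sumr_const card_ord -[d.+3%:R]natr1 addrK.
Qed.

(** * Pairings with finitely supported matrices *)

Section FiniteMatrices.
Variables (R : realType) (I : choiceType).
Implicit Types (A B : I -> I -> R).

(** [s] collects the row and column indices that occur in the support, so one finite square serves
    for every [B]. *)
Lemma mxinner_finite A : finitely_supported A ->
  exists s : {fset I}, forall B,
    mxinner A B = \sum_(i <- s) \sum_(j <- s) A i j * B i j.
Proof.
move=> Afin; pose S := [set p : I * I | A p.1 p.2 != 0].
pose s := fset_set (S.`1 `|` S.`2).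
have sS : [set` s] = S.`1 `|` S.`2.
  rewrite fset_setK// finite_setU; split; first exact: finite_set_fst.
  exact: finite_set_snd.
exists s => B; have -> : \sum_(i <- s) \sum_(j <- s) A i j * B i j =
    \sum_(p <- [seq (i, j) | i <- s, j <- s]) A p.1 p.2 * B p.1 p.2.
  by rewrite big_allpairs_dep.
rewrite /mxinner.
rewrite [RHS]fsbig_seq; last first.
  apply: (@allpairs_uniq _ _ _ (fun i j => (i, j)) s s) => //.
  by move=> [a b] [a' b'] _ _ [-> ->].
apply/esym/fsbig_widen => // -[i j] /= [_ ijs].
have [->|Aij] := eqVneq (A i j) 0; first by rewrite mul0r.
exfalso; apply: ijs; rewrite allpairs_f//.
  have : [set` s] i by rewrite sS; left; exists j.
  by [].
have : [set` s] j by rewrite sS; right; exists i.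
by [].
Qed.

Lemma mxinnerD A B B' : finitely_supported A ->
  mxinner A (fun i j => B i j + B' i j) = mxinner A B + mxinner A B'.
Proof.
move=> /mxinner_finite[s sE]; rewrite !sE -big_split; apply: eq_bigr => i _.
by rewrite -big_split; apply: eq_bigr => j _; rewrite mulrDr.
Qed.

Lemma mxinnerZ a A B : finitely_supported A ->
  mxinner A (fun i j => a * B i j) = a * mxinner A B.
Proof.
move=> /mxinner_finite[s sE]; rewrite !sE mulr_sumr; apply: eq_bigr => i _.
by rewrite mulr_sumr; apply: eq_bigr => j _; rewrite mulrCA.
Qed.

Lemma mxinner0 A : mxinner A (fun _ _ => 0) = 0.
Proof. by rewrite /mxinner fsbig1// => p _; rewrite mulr0. Qed.

(** Expanding [K] into features leaves, for each feature h, the quadratic form of [A] at the vector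
    whose entry at i is the sum of [w i y * h y] over [r]. *)
Lemma mxinner_schur_ge0 (V : lmodType R) A (K : V -> V -> R)
    (w : I -> V -> R) (r : seq V) :
  finitely_supported A -> psd A -> features K ->
  0 <= \sum_(y <- r) \sum_(z <- r) mxinner A (fun i j => w i y * w j z * K y z).
Proof.
move=> /mxinner_finite[s sE] [_ Apos] [hs hsE].
have -> : \sum_(y <- r) \sum_(z <- r) mxinner A (fun i j => w i y * w j z * K y z) =
    \sum_(h <- hs) \sum_(i <- s) \sum_(j <- s)
      (\sum_(y <- r) w i y * h y) * A i j * (\sum_(y <- r) w j y * h y).
  transitivity (\sum_(h <- hs) \sum_(i <- s) \sum_(j <- s) \sum_(y <- r) \sum_(z <- r)
      (w i y * h y) * A i j * (w j z * h z)).
    under eq_bigr do under eq_bigr do rewrite sE.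
    under eq_bigr do rewrite exchange_big.
    rewrite exchange_big [RHS]exchange_big; apply: eq_bigr => i _ /=.
    under eq_bigr do rewrite exchange_big.
    rewrite exchange_big [RHS]exchange_big; apply: eq_bigr => j _ /=.
    rewrite [RHS]exchange_big; apply: eq_bigr => y _.
    rewrite [RHS]exchange_big; apply: eq_bigr => z _.
    by rewrite hsE !mulr_sumr; apply: eq_bigr => h _; ring.
  apply: eq_bigr => h _; apply: eq_bigr => i _; apply: eq_bigr => j _.
  by rewrite mulr_suml mulr_suml; apply: eq_bigr => y _; rewrite mulr_sumr.
by apply: sumr_ge0 => h _; exact: Apos.
Qed.

End FiniteMatrices.

Lemma sum_cst_seq (R : realType) (T : Type) (r : seq T) (b : R) :
  \sum_(y <- r) b = (size r)%:R * b.
Proof. by rewrite big_const_seq count_predT iter_addr_0 mulr_natl. Qed.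

(** * Sums over triples of points *)

Section TripleSums.
Variables (R : realType) (T : eqType) (r : seq T).
Implicit Types (Phi : T -> T -> T -> R) (Psi : T -> T -> R).

Definition sum3 Phi := \sum_(x <- r) \sum_(y <- r) \sum_(z <- r) Phi x y z.

Definition distinct_sum3 Phi := sum3 (fun x y z =>
  if [&& x != y, x != z & y != z] then Phi x y z else 0).

Definition distinct_sum2 Psi := \sum_(x <- r) \sum_(y <- r | x != y) Psi x y.

Lemma eq_sum3 Phi Phi' :
  (forall x y z, x \in r -> y \in r -> z \in r -> Phi x y z = Phi' x y z) ->
  sum3 Phi = sum3 Phi'.
Proof.
move=> h; rewrite /sum3 big_seq [RHS]big_seq; apply: eq_bigr => x xr.
rewrite big_seq [RHS]big_seq; apply: eq_bigr => y yr.
by rewrite big_seq [RHS]big_seq; apply: eq_bigr => z zr; exact: h.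
Qed.

Lemma sum3D Phi Phi' :
  sum3 (fun x y z => Phi x y z + Phi' x y z) = sum3 Phi + sum3 Phi'.
Proof.
rewrite /sum3 -big_split; apply: eq_bigr => x _.
by rewrite -big_split; apply: eq_bigr => y _; rewrite -big_split.
Qed.

Lemma sum3Z a Phi : sum3 (fun x y z => a * Phi x y z) = a * sum3 Phi.
Proof.
rewrite /sum3 mulr_sumr; apply: eq_bigr => x _.
by rewrite mulr_sumr; apply: eq_bigr => y _; rewrite mulr_sumr.
Qed.

Lemma sum3_swap12 Phi : sum3 (fun x y z => Phi y x z) = sum3 Phi.
Proof. exact: exchange_big. Qed.

Lemma sum3_swap23 Phi : sum3 (fun x y z => Phi x z y) = sum3 Phi.
Proof. by apply: eq_bigr => x _; exact: exchange_big. Qed.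

Lemma distinct_sum3D Phi Phi' :
  distinct_sum3 (fun x y z => Phi x y z + Phi' x y z) =
  distinct_sum3 Phi + distinct_sum3 Phi'.
Proof.
by rewrite -sum3D; apply: eq_sum3 => x y z _ _ _; case: ifP => //; rewrite addr0.
Qed.

Lemma distinct_sum3Z a Phi :
  distinct_sum3 (fun x y z => a * Phi x y z) = a * distinct_sum3 Phi.
Proof.
by rewrite -sum3Z; apply: eq_sum3 => x y z _ _ _; case: ifP => //; rewrite mulr0.
Qed.

Lemma distinct_sum3_swap12 Phi :
  distinct_sum3 (fun x y z => Phi y x z) = distinct_sum3 Phi.
Proof.
rewrite /distinct_sum3 -[RHS]sum3_swap12; apply: eq_sum3 => x y z _ _ _.
by rewrite (eq_sym y x) andbCA [(y != z) && _]andbC andbCA.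
Qed.

Lemma distinct_sum3_swap23 Phi :
  distinct_sum3 (fun x y z => Phi x z y) = distinct_sum3 Phi.
Proof.
rewrite /distinct_sum3 -[RHS]sum3_swap23; apply: eq_sum3 => x y z _ _ _.
by rewrite (eq_sym z y) andbCA.
Qed.

Hypothesis ur : uniq r.

Lemma sum_pick x (F : T -> R) : x \in r ->
  \sum_(z <- r) (if x == z then F z else 0) = F x.
Proof.
move=> xr; rewrite (bigD1_seq x)//= eqxx big1 ?addr0// => z /negPf zx.
by rewrite eq_sym zx.
Qed.

Lemma distinct_sum2_cst a :
  distinct_sum2 (fun _ _ => a) = (size r)%:R * ((size r)%:R - 1) * a.
Proof.
transitivity (\sum_(x <- r) ((size r)%:R * a - a)).
  rewrite /distinct_sum2 big_seq [RHS]big_seq; apply: eq_bigr => x xr.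
  rewrite -sum_cst_seq (bigD1_seq x)//= [a + _]addrC addrK.
  by apply: eq_bigl => y; rewrite eq_sym.
by rewrite sum_cst_seq; ring.
Qed.

(** A pair of distinct points has [size r - 2] completions to a triple of distinct points. *)
Lemma distinct_sum3_fst2 Psi :
  distinct_sum3 (fun x y _ => Psi x y) = ((size r)%:R - 2) * distinct_sum2 Psi.
Proof.
rewrite /distinct_sum3 /sum3 /distinct_sum2 mulr_sumr big_seq [RHS]big_seq.
apply: eq_bigr => x xr; rewrite mulr_sumr [RHS]big_mkcond [LHS]big_seq [RHS]big_seq.
apply: eq_bigr => y yr; have [xy|xy] := boolP (x != y); last first.
  by rewrite big1.
rewrite /= mulrBl -sum_cst_seq.
transitivity (\sum_(z <- r) (Psi x y - (if x == z then Psi x y else 0)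
    - (if y == z then Psi x y else 0))).
  apply: eq_bigr => z _; have [xz|xz] := eqVneq x z.
    by rewrite subrr -xz eq_sym (negPf xy) subr0.
  by have [yz|yz] := eqVneq y z; rewrite ?subr0 ?subrr.
rewrite !sumrB !sum_pick//; ring.
Qed.

(** Triples split by coincidence pattern: all distinct, exactly two equal in three ways, all
    equal. *)
Lemma sum3_decomp Phi Psi :
  (forall x y, x \in r -> y \in r -> Phi x x y = Psi x y) ->
  (forall x y, x \in r -> y \in r -> Phi x y x = Psi x y) ->
  (forall x y, x \in r -> y \in r -> Phi x y y = Psi x y) ->
  sum3 Phi = distinct_sum3 Phi + 3 * distinct_sum2 Psi + \sum_(x <- r) Psi x x.
Proof.
move=> h1 h2 h3; rewrite /distinct_sum3 /sum3 /distinct_sum2 mulr_sumr -!big_split/=.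
rewrite big_seq [RHS]big_seq; apply: eq_bigr => x xr.
rewrite (bigD1_seq x)//= [X in _ = X + _ + _](bigD1_seq x)//= eqxx/= big1_eq add0r.
rewrite [LHS]addrC.
have -> : \sum_(z <- r) Phi x x z = Psi x x + \sum_(y <- r | x != y) Psi x y.
  rewrite (bigD1_seq x)//= h1//; congr (_ + _).
  rewrite big_seq_cond [RHS]big_seq_cond; apply: eq_big => [y|y /andP[yr _]].
    by rewrite eq_sym.
  by rewrite h1.
set S2 := \sum_(y <- r | x != y) Psi x y.
suff -> : \sum_(y <- r | y != x) \sum_(z <- r) Phi x y z =
    \sum_(y <- r | y != x) \sum_(z <- r)
      (if [&& x != y, x != z & y != z] then Phi x y z else 0) + 2 * S2.
  by ring.
have -> : S2 = \sum_(y <- r | y != x) Psi x y.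
  by apply: eq_bigl => y; rewrite eq_sym.
rewrite mulr_sumr -big_split/=.
rewrite big_seq_cond [RHS]big_seq_cond; apply: eq_bigr => y /andP[yr yx].
rewrite eq_sym yx/=.
transitivity (\sum_(z <- r) ((if (x != z) && (y != z) then Phi x y z else 0)
    + (if x == z then Phi x y z else 0) + (if y == z then Phi x y z else 0))).
  apply: eq_bigr => z _; have [xz|xz] := eqVneq x z.
    by rewrite -xz (negPf yx) add0r addr0.
  by have [yz|yz] := eqVneq y z; rewrite ?add0r ?addr0.
by rewrite !big_split/= !sum_pick// h2// h3//; ring.
Qed.

Lemma le_sum3 Phi Phi' :
  (forall x y z, x \in r -> y \in r -> z \in r -> Phi x y z <= Phi' x y z) ->
  sum3 Phi <= sum3 Phi'.
Proof.
move=> h; rewrite /sum3 big_seq [leRHS]big_seq; apply: ler_sum => x xr.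
rewrite big_seq [leRHS]big_seq; apply: ler_sum => y yr.
by rewrite big_seq [leRHS]big_seq; apply: ler_sum => z zr; exact: h.
Qed.

End TripleSums.

Lemma cvg_sum_seq (R : realType) (T : eqType) (r : seq T) (f : T -> nat -> R) (l : T -> R) :
  (forall x, x \in r -> f x k @[k --> \oo] --> l x) ->
  (\sum_(x <- r) f x k) @[k --> \oo] --> \sum_(x <- r) l x.
Proof.
elim: r => [|a r IH] h.
  by rewrite big_nil; under eq_fun do rewrite big_nil; exact: cvg_cst.
rewrite big_cons; under eq_fun do rewrite big_cons.
apply: cvgD; first by apply: h; rewrite mem_head.
by apply: IH => x xr; apply: h; rewrite inE xr orbT.
Qed.

Lemma cvg_sum3 (R : realType) (T : eqType) (r : seq T)
    (f : T -> T -> T -> nat -> R) (l : T -> T -> T -> R) :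
  (forall x y z, x \in r -> y \in r -> z \in r -> f x y z k @[k --> \oo] --> l x y z) ->
  sum3 r (fun x y z => f x y z k) @[k --> \oo] --> sum3 r l.
Proof.
move=> h; apply: cvg_sum_seq => x xr; apply: cvg_sum_seq => y yr.
by apply: cvg_sum_seq => z zr; exact: h.
Qed.

Lemma distinct_sum3_pairs (R : realType) (T : eqType) (r : seq T) (Psi : T -> T -> R) :
  uniq r ->
  distinct_sum3 r (fun x y z => Psi x y + Psi x z + Psi y z) =
  ((size r)%:R - 2) * (3 * distinct_sum2 r Psi).
Proof.
move=> ur; rewrite !distinct_sum3D.
have -> : distinct_sum3 r (fun x y z => Psi y z) = distinct_sum3 r (fun x y z => Psi x z).
  exact: (distinct_sum3_swap12 r (fun x y z => Psi x z)).
have -> : distinct_sum3 r (fun x y z => Psi x z) = distinct_sum3 r (fun x y _ => Psi x y).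
  exact: (distinct_sum3_swap23 r (fun x y z => Psi x y)).
by rewrite distinct_sum3_fst2//; ring.
Qed.

(** * Positivity summed over the configuration *)

Section ThreePoint.
Variables (R : realType) (d : nat) (P : nat -> {poly R}).
Hypothesis hP : is_gegenbauer d.+2 P.
Variable r : seq 'rV[R]_d.+3.
Hypothesis r_unit : forall x, x \in r -> dot x x = 1.

Lemma Smx_swap12 k (u v t : R) i j : Smx P k u v t i j = Smx P k v u t i j.
Proof. by rewrite /Smx /symmetrize; ring. Qed.

Lemma Smx_swap23 k (u v t : R) i j : Smx P k u v t i j = Smx P k u t v i j.
Proof. by rewrite /Smx /symmetrize; ring. Qed.

Lemma sum3_Shat_ge0 k (F : parity_index k -> parity_index k -> R) :
  finitely_supported F -> psd F ->
  0 <= sum3 r (fun x y z => mxinner F (@Shat R P k (dot x y) (dot x z) (dot y z))).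
Proof.
move=> Ffin Fpsd.
(* [G] is the pairing before symmetrization; for fixed x its sum over y and z falls under
   [mxinner_schur_ge0], with the kernel on the complement of x. *)
pose G (x y z : 'rV[R]_d.+3) := mxinner F (fun i j : parity_index k =>
  dot x y ^+ val i * dot x z ^+ val j * zonal (P k) k (dot x y) (dot x z) (dot y z)).
have G0 : 0 <= sum3 r G.
  rewrite /sum3 big_seq; apply: sumr_ge0 => x xr.
  have := mxinner_schur_ge0 (fun i : parity_index k => fun y => dot x y ^+ val i) r
    Ffin Fpsd (zonal_perp_features k (r_unit xr)).
  congr (0 <= _); rewrite big_seq [RHS]big_seq; apply: eq_bigr => y yr.
  rewrite big_seq [RHS]big_seq; apply: eq_bigr => z zr.
  congr mxinner; apply/funext => i; apply/funext => j.
  by rewrite /zonal (gegenbauer_zonal_poly k hP) /dot_perp !r_unit// !expr2.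
(* Symmetrization permutes the three points, so its six terms have equal sums over all triples. *)
have -> : sum3 r (fun x y z => mxinner F (@Shat R P k (dot x y) (dot x z) (dot y z))) =
   sum3 r (fun x y z => 6^-1 *
     (G x y z + G y x z + G x z y + G z x y + G y z x + G z y x)).
  apply: eq_sum3 => x y z _ _ _.
  rewrite /G -!mxinnerD// -mxinnerZ//; congr mxinner.
  apply/funext => i; apply/funext => j; rewrite /Shat /Smx /symmetrize.
  by rewrite (dotC y x) (dotC z x) (dotC z y) mulrC.
rewrite sum3Z !sum3D (sum3_swap12 r G) (sum3_swap23 r G).
have -> : sum3 r (fun x y z => G z x y) = sum3 r G.
  by rewrite (sum3_swap23 r (fun x y z => G y x z)) sum3_swap12.
have -> : sum3 r (fun x y z => G y z x) = sum3 r G.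
  by rewrite (sum3_swap12 r (fun x y z => G x z y)) sum3_swap23.
have -> : sum3 r (fun x y z => G z y x) = sum3 r G.
  rewrite (sum3_swap12 r (fun x y z => G z x y)).
  by rewrite (sum3_swap23 r (fun x y z => G y x z)) sum3_swap12.
lra.
Qed.

Hypothesis ur : uniq r.

Lemma distinct_sum3_That_ge k (F : parity_index k -> parity_index k -> R) :
  (2 < size r)%N -> finitely_supported F -> psd F ->
  - (((size r)%:R - 2) * (size r)%:R * mxinner F (@Shat R P k 1 1 1)) <=
  distinct_sum3 r (fun x y z =>
    mxinner F (@That R P (size r) k (dot x y) (dot x z) (dot y z))).
Proof.
move=> hr Ffin Fpsd.
pose S (x y z : 'rV[R]_d.+3) := mxinner F (@Shat R P k (dot x y) (dot x z) (dot y z)).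
pose Psi (x y : 'rV[R]_d.+3) := mxinner F (@Shat R P k (dot x y) (dot x y) 1).
(* The last three terms of [That] depend on one pair each, and every pair lies in N - 2 triples;
   this matches the factor N - 2 in front of [Shat]. *)
have -> : distinct_sum3 r (fun x y z =>
    mxinner F (@That R P (size r) k (dot x y) (dot x z) (dot y z))) =
  ((size r)%:R - 2) * (distinct_sum3 r S + 3 * distinct_sum2 r Psi).
  rewrite mulrDr -distinct_sum3_pairs// -distinct_sum3Z -distinct_sum3D.
  apply: eq_sum3 => x y z _ _ _; case: ifP => // _.
  by rewrite /That !mxinnerD// mxinnerZ// !addrA.
have Sge0 := sum3_Shat_ge0 Ffin Fpsd; rewrite -/S in Sge0.
(* The same pair terms arise from the triples with exactly two equal points. *)
have SE : sum3 r S = distinct_sum3 r S + 3 * distinct_sum2 r Psi +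
    \sum_(x <- r) Psi x x.
  apply: sum3_decomp => // x y xr yr; rewrite /S /Psi.
  - rewrite r_unit//; congr mxinner; apply/funext => i; apply/funext => j.
    by rewrite /Shat Smx_swap12 Smx_swap23.
  - rewrite r_unit// (dotC y x); congr mxinner; apply/funext => i; apply/funext => j.
    by rewrite /Shat Smx_swap23.
  - by rewrite r_unit.
have diagE : \sum_(x <- r) Psi x x = (size r)%:R * mxinner F (@Shat R P k 1 1 1).
  transitivity (\sum_(x <- r) mxinner F (@Shat R P k 1 1 1)).
    by rewrite big_seq [RHS]big_seq; apply: eq_bigr => x xr; rewrite /Psi r_unit.
  exact: sum_cst_seq.
rewrite -mulrA -mulrN ler_pM2l; last by rewrite subr_gt0 ltr_nat.
by rewrite -diagE; move: Sge0; rewrite SE; lra.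
Qed.

Lemma mxinner_Shat1 k (F : parity_index k -> parity_index k -> R) :
  mxinner F (@Shat R P k 1 1 1) = if k is 0 then mxinner F allones else 0.
Proof.
(* Here t - uv and (1 - u^2)(1 - v^2) are both 0, so only a term with both exponents 0 survives,
   which forces k = 0. *)
have zE : zonal (P k) k 1 1 1 = (k == 0)%:R.
  rewrite /zonal (gegenbauer_zonal_poly k hP) mulr1 expr1n subrr mul0r.
  case: k F => [|k] _.
    by rewrite big_mkcond big_ord1/= coefC/= !mulr1.
  rewrite big1// => -[[|j] jk]/= par; last by rewrite expr0n/= mulr0 mul0r.
  by case: k jk par => // k jk par; rewrite [X in _ * X = _]expr0n mulr0.
have SE i j : Smx P k 1 1 1 i j = (k == 0)%:R.
  by rewrite /Smx /symmetrize zE !expr1n !mul1r; lra.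
case: k F zE SE => [|k] F _ SE.
  by congr mxinner; apply/funext => i; apply/funext => j; rewrite /Shat SE.
rewrite -[RHS](mxinner0 F); congr mxinner.
by apply/funext => i; apply/funext => j; rewrite /Shat SE.
Qed.

(** Every term with k > 0 has a nonnegative sum; the range up to [K.+1] ensures that k = 0 is
    present. *)
Lemma distinct_sum3_series_ge (F : forall k : nat, parity_index k -> parity_index k -> R) K :
  (2 < size r)%N -> (forall k, finitely_supported (@F k)) -> (forall k, psd (@F k)) ->
  - (((size r)%:R - 2) * (size r)%:R * mxinner (@F 0%N) allones) <=
  distinct_sum3 r (fun x y z => \sum_(0 <= k < K.+1)
    mxinner (@F k) (@That R P (size r) k (dot x y) (dot x z) (dot y z))).
Proof.
move=> hr Ffin Fpsd; elim: K => [|K IH].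
  under [X in _ <= X]eq_sum3 do rewrite big_nat1.
  have := distinct_sum3_That_ge hr (Ffin 0%N) (Fpsd 0%N).
  by rewrite mxinner_Shat1.
have -> : distinct_sum3 r (fun x y z => \sum_(0 <= k < K.+2)
    mxinner (@F k) (@That R P (size r) k (dot x y) (dot x z) (dot y z))) =
  distinct_sum3 r (fun x y z => \sum_(0 <= k < K.+1)
    mxinner (@F k) (@That R P (size r) k (dot x y) (dot x z) (dot y z))) +
  distinct_sum3 r (fun x y z =>
    mxinner (@F K.+1) (@That R P (size r) K.+1 (dot x y) (dot x z) (dot y z))).
  rewrite -distinct_sum3D; apply: eq_sum3 => x y z _ _ _.
  by rewrite big_nat_recr.
have := distinct_sum3_That_ge hr (Ffin K.+1) (Fpsd K.+1).
rewrite mxinner_Shat1; lra.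
Qed.

End ThreePoint.

Theorem theorem8 (R : realType) (n N : nat) (hn : (3 <= n)%N) (hN : (2 < N)%N)
  (f : R -> R)
  (P : nat -> {poly R}) (hP : is_gegenbauer n.-1 P)
  (c : R) (F : forall k : nat, parity_index k -> parity_index k -> R)
  (hFfin : forall k, finitely_supported (@F k))
  (hFpsd : forall k, psd (@F k))
  (H : R -> R -> R -> R)
  (hH : forall u v t : R, Dset u v t ->
     (c + \sum_(0 <= k < K) mxinner (@F k) (@That R P N k u v t))
       @[K --> \oo] --> H u v t)
  (hle : forall u v t : R, Dset u v t ->
     H u v t <= (f (u ^+ 2) + f (v ^+ 2) + f (t ^+ 2)) / 3)
  (C : {fset 'rV[R]_n}) (hC : projective_config C) (hCN : #|` C| = N) :
  N%:R / 2 * ((N%:R - 1) * c - mxinner (@F 0%N) allones) <= energy f C.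
Proof.
case: n hn hP C hC hCN => [|[|[|d]]]// _ hP C [C_unit C_neq] hCN.
have uC := fset_uniq C.
pose r : seq 'rV[R]_d.+3 := C.
have sr : size r = N by [].
have inD x y z : x \in r -> y \in r -> z \in r -> [&& x != y, x != z & y != z] ->
    Dset (dot x y) (dot x z) (dot y z).
  move=> xr yr zr /and3P[xy xz yz].
  split; last by apply: gram3_ge0; exact: C_unit.
  - by apply: unit_dot_lt1; [exact: C_unit|exact: C_unit| |exact: C_neq].
  - by apply: unit_dot_lt1; [exact: C_unit|exact: C_unit| |exact: C_neq].
  - by apply: unit_dot_lt1; [exact: C_unit|exact: C_unit| |exact: C_neq].
pose M K (x y z : 'rV[R]_d.+3) := c + \sum_(0 <= k < K)
  mxinner (@F k) (@That R P N k (dot x y) (dot x z) (dot y z)).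
(* Convergence is available only on D, which contains the triples of inner products of distinct
   points. *)
have cvgM : distinct_sum3 r (M K) @[K --> \oo] -->
    distinct_sum3 r (fun x y z => H (dot x y) (dot x z) (dot y z)).
  apply: cvg_sum3 => x y z xr yr zr.
  by case: ifPn => [xyz|_]; [apply: hH; exact: inD|exact: cvg_cst].
(* This is 2 (N - 2) times the claimed bound: N - 2 counts the triples over a pair, and 2 offsets
   the factor 1/2 of the energy. *)
pose m := (N%:R - 2) * (N%:R * ((N%:R - 1) * c - mxinner (@F 0%N) allones)).
have Mge K : m <= distinct_sum3 r (M K.+1).
  rewrite /M distinct_sum3D.
  rewrite (distinct_sum3_fst2 uC (fun _ _ => c)) distinct_sum2_cst// -/r sr.
  have := distinct_sum3_series_ge hP C_unit uC K _ hFfin hFpsd.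
  by rewrite -/r sr => /(_ hN); rewrite /m; lra.
have mH : m <= distinct_sum3 r (fun x y z => H (dot x y) (dot x z) (dot y z)).
  (* The empty partial sum lacks the term of [F 0], so the bound starts at [K = 1]. *)
  apply: (cvgr_to_ge cvgM); exists 1%N => // -[|K] _//; exact: Mge.
pose fd (x y : 'rV[R]_d.+3) : R := f (dot x y ^+ 2).
have Hf : distinct_sum3 r (fun x y z => H (dot x y) (dot x z) (dot y z)) <=
    (N%:R - 2) * distinct_sum2 r fd.
  apply: (@le_trans _ _ (distinct_sum3 r (fun x y z => 3^-1 * (fd x y + fd x z + fd y z)))).
    apply: le_sum3 => x y z xr yr zr; case: ifPn => // xyz.
    by rewrite mulrC; apply: hle; exact: inD.
  by rewrite distinct_sum3Z distinct_sum3_pairs// sr; lra.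
have N2 : 0 < N%:R - 2 :> R by rewrite subr_gt0 ltr_nat.
have := le_trans mH Hf; rewrite /m ler_pM2l//.
rewrite /energy -/(distinct_sum2 r fd); lra.
Qed.
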